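(* For an alphabet $\Sigma=\{\sigma_1,\dots,\sigma_k\}$ of size $k\ge 2$, let $r_{k,n}$ be the number of expressions of size $n$ in $\mathrm{RE}_{na}$ and $t_{k,n}$ the total number of transitions of the Glushkov automata of all expressions of size $n$ in $\mathrm{RE}_{na}$. Then for each $k$ there is a constant $\lambda_k$ such that $\frac{t_{k,n}}{r_{k,n}}\sim \lambda_k\, n$ as $n\to\infty$, and $\lim_{k\to\infty}\lambda_k=1$.
   Context: Regular expressions over $\Sigma$ are generated by $\beta := \varepsilon \mid \sigma\ (\sigma\in\Sigma) \mid (\beta+\beta) \mid (\beta\cdot\beta) \mid (\beta^\star)$ (the empty-set expression is not counted). The size $|\beta|$ is the number of occurrences of the symbols $\varepsilon$, letters, $+$, $\cdot$, $\star$ in $\beta$ (parentheses not counted). A $\Sigma$-star expression is an expression $(\tau^\star)$ where $\tau$ is a fully parenthesized union of the $k$ letters, each occurring exactly once, in any order and any bracketing. $\mathrm{RE}_{na}$ is the set of regular expressions having no subexpression $(\beta_1+\beta_2)$ in which $\beta_1$ or $\beta_2$ is a $\Sigma$-star expression. Glushkov automaton: number the letter occurrences of $\beta$ from left to right as positions $1,\dots,|\beta|_\Sigma$, and let $\overline\beta$ be $\beta$ with each letter marked by its position. Let $\mathrm{First}(\beta)$ be the set of positions $i$ such that some word of $\mathcal L(\overline\beta)$ begins with the letter marked $i$, $\mathrm{Last}(\beta)$ the set of positions $i$ such that some word of $\mathcal L(\overline\beta)$ ends with the letter marked $i$, and $\mathrm{Follow}(\beta)$ the set of pairs $(i,j)$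 such that some word of $\mathcal L(\overline\beta)$ contains the letter marked $i$ immediately followed by the letter marked $j$. The Glushkov automaton of $\beta$ has states $\{0,1,\dots,|\beta|_\Sigma\}$, initial state $0$, transitions $(0,\sigma_j,j)$ for $j\in\mathrm{First}(\beta)$ and $(i,\sigma_j,j)$ for $(i,j)\in\mathrm{Follow}(\beta)$ (where $\sigma_j$ is the letter at position $j$), and final states $\mathrm{Last}(\beta)$, together with $0$ if $\varepsilon\in\mathcal L(\beta)$. Thus its number of transitions is $|\mathrm{First}(\beta)|+|\mathrm{Follow}(\beta)|$. $a_n\sim b_n$ means $a_n/b_n\to1$. *)

(* Defs.v *)
From mathcomp Require Import all_boot.
From Stdlib Require Import ClassicalEpsilon.

Set Implicit Arguments.
Unset Strict Implicit.
Unset Printing Implicit Defensive.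

(* Regular expressions; letters are the naturals 0..k-1 standing for
   sigma_1..sigma_k (an expression "over Sigma_k" uses only letters < k). *)
Inductive regex : Type :=
| Eps : regex
| Sym : nat -> regex
| Plus : regex -> regex -> regex
| Cat : regex -> regex -> regex
| Star : regex -> regex.

Fixpoint re_size (e : regex) : nat :=
  match e with
  | Eps => 1
  | Sym _ => 1
  | Plus e1 e2 => (re_size e1 + re_size e2).+1
  | Cat e1 e2 => (re_size e1 + re_size e2).+1
  | Star e1 => (re_size e1).+1
  end.

Fixpoint letters (e : regex) : seq nat :=
  match e with
  | Eps => [::]
  | Sym a => [:: a]
  | Plus e1 e2 => letters e1 ++ letters e2
  | Cat e1 e2 => letters e1 ++ letters e2
  | Star e1 => letters e1
  end.

Definition nsym (e : regex) : nat := size (letters e).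

(* all expressions of size n over the alphabet {0..k-1}
   (fuel m >= n guarantees termination; each expression listed once) *)
Fixpoint enum_aux (k m n : nat) : seq regex :=
  match m with
  | 0 => [::]
  | m'.+1 =>
    match n with
    | 0 => [::]
    | 1 => Eps :: map Sym (iota 0 k)
    | n'.+1 =>
        map Star (enum_aux k m' n')
        ++ flatten [seq [seq Plus e1 e2 | e1 <- enum_aux k m' i,
                                         e2 <- enum_aux k m' (n' - i)]
                   | i <- iota 1 (n'.-1)]
        ++ flatten [seq [seq Cat e1 e2 | e1 <- enum_aux k m' i,
                                        e2 <- enum_aux k m' (n' - i)]
                   | i <- iota 1 (n'.-1)]
    end
  end.

Definition enum_re (k n : nat) : seq regex := enum_aux k n n.

Fixpoint union_of_syms (e : regex) : bool :=
  match e with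
  | Sym _ => true
  | Plus e1 e2 => union_of_syms e1 && union_of_syms e2
  | _ => false
  end.

Definition sigma_star (k : nat) (e : regex) : bool :=
  match e with
  | Star t => union_of_syms t && perm_eq (letters t) (iota 0 k)
  | _ => false
  end.

Fixpoint re_na (k : nat) (e : regex) : bool :=
  match e with
  | Eps => true
  | Sym _ => true
  | Plus e1 e2 =>
      [&& ~~ sigma_star k e1, ~~ sigma_star k e2, re_na k e1 & re_na k e2]
  | Cat e1 e2 => re_na k e1 && re_na k e2
  | Star e1 => re_na k e1
  end.

(* Language of the marked expression: [marked e off w] means that the word w
   of positions belongs to L(e-bar), where the letter occurrences of e are
   numbered off+1, off+2, ... from left to right.  With off = 0 this is the
   marking of the statement (positions 1..|e|_Sigma). *)
Inductive marked : regex -> nat -> seq nat -> Prop :=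
| mEps off : marked Eps off [::]
| mSym a off : marked (Sym a) off [:: off.+1]
| mPlusL e1 e2 off w : marked e1 off w -> marked (Plus e1 e2) off w
| mPlusR e1 e2 off w :
    marked e2 (off + nsym e1) w -> marked (Plus e1 e2) off w
| mCat e1 e2 off w1 w2 :
    marked e1 off w1 -> marked e2 (off + nsym e1) w2 ->
    marked (Cat e1 e2) off (w1 ++ w2)
| mStar0 e off : marked (Star e) off [::]
| mStarS e off w1 w2 :
    marked e off w1 -> marked (Star e) off w2 ->
    marked (Star e) off (w1 ++ w2).

Definition ind (P : Prop) : nat :=
  if excluded_middle_informative P then 1 else 0.

Definition First (e : regex) (i : nat) : Prop :=
  exists w, marked e 0 (i :: w).

Definition Follow (e : regex) (i j : nat) : Prop :=
  exists u v, marked e 0 (u ++ i :: j :: v).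

Definition glushkov_transitions (e : regex) : nat :=
  \sum_(1 <= i < (nsym e).+1) ind (First e i)
  + \sum_(1 <= i < (nsym e).+1) \sum_(1 <= j < (nsym e).+1) ind (Follow e i j).

Definition r_count (k n : nat) : nat := count (re_na k) (enum_re k n).

Definition t_count (k n : nat) : nat :=
  \sum_(e <- enum_re k n | re_na k e) glushkov_transitions e.

(* Main.v *)
(* Let R, M, F, X, E be the generating functions, over RE_na, of 1, non-nullability, |First|
   (equal to that of |Last|), |Last x First \ Follow| and |Follow|, and let S = s z^(2k)
   count the Sigma-star expressions.  The structural recursions give polynomial equations.
   That of R is quadratic with discriminant D = (1 - z + 2zS)^2 - 8z^2(k + 1 + S^2), a
   polynomial, so that 1 - Q = sqrt D for the series Q = z + 4zR - 2zS >= 0; those of M, F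
   and X have solutions regular enough at the radius rho, and E = G / sqrt D with
   G = zX + zF^2 - 2 k^2 z S (R - S).  Since theta Q = - theta D / (2 sqrt D), where
   theta = z d/dz, both n r_n and t_n are governed by the coefficients of 1 / sqrt D, whence
   lambda_k = 8 rho G(rho) / (- theta D (rho)).

   Positivity of Q makes rho the only root of D of minimal modulus.  It is a simple root,
   and G(rho) > 0, because the bodies of the Sigma-star expressions already give
   k S <= z F and k^2 S <= z X.  Writing D = (1 - z / rho) H, the series H^(-1/2) is a
   product of dilated copies of (1 - z)^(-1/2), one for each of the other complex roots,
   which reduces everything to central binomial coefficients.  Finally the equations at rho
   give k rho^2 -> 1/8, rho F(rho) -> 1/2, rho^2 X(rho) -> 0, and thus
   |lambda_k - 1| = O(rho), where rho is of order k^(-1/2). *)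
From HB Require Import structures.
From Stdlib Require Import Reals.
From Coquelicot Require Import Coquelicot.
From mathcomp Require Import all_boot all_order all_algebra ring lra zify.
From mathcomp Require Import boolp classical_sets functions reals topology.
From mathcomp Require Import normedtype sequences complex polyrcf Rstruct.
Require Import Defs.

Local Close Scope R_scope.
Local Open Scope nat_scope.
Set Implicit Arguments.
Unset Strict Implicit.
Unset Printing Implicit Defensive.

(** * First, Last and Follow *)

(** Neither s nor rho is ever computed. What is used of s is its sign and the comparisons of S with
    F and X; read at rho, the first one also yields k S(rho) <= 1, which controls the Sigma-star
    terms uniformly in k.

    Transfer theorems usually rest on analytic continuation. Here everything stays on coefficients:
    after the substitution of rho z for z, a real series a is called smooth when it is absolutely
    summable and n a_n tends to 0. Multiplying (1 - z)^(-1/2) by a smooth series multiplies its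
    coefficients, asymptotically, by the sum of that series. Complex numbers serve only to locate
    and factor out the roots of D.

    There is an apparent circle: F and X must be smooth before E can be treated, but their equations
    involve R, which carries the square root singularity. It is broken in two stages. Summability
    comes first, of Q by positivity, then of F and X by absorption in linear equations whose kernels
    have sum less than 1. The asymptotics of theta Q, which involve D alone, then show that Q is
    smooth, and smoothness passes to M, F and X through their linear equations. *)

Fixpoint nullable (e : regex) : bool :=
  match e with
  | Eps => true
  | Sym _ => false
  | Plus a b => nullable a || nullable b
  | Cat a b => nullable a && nullable b
  | Star _ => true
  end.

Fixpoint firstb (e : regex) (off i : nat) : bool :=
  match e with
  | Eps => false
  | Sym _ => i == off.+1
  | Plus a b => firstb a off i || firstb b (off + nsym a) i
  | Cat a b => firstb a off i || nullable a && firstb b (off + nsym a) i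
  | Star a => firstb a off i
  end.

Fixpoint lastb (e : regex) (off i : nat) : bool :=
  match e with
  | Eps => false
  | Sym _ => i == off.+1
  | Plus a b => lastb a off i || lastb b (off + nsym a) i
  | Cat a b => lastb b (off + nsym a) i || nullable b && lastb a off i
  | Star a => lastb a off i
  end.

Fixpoint followb (e : regex) (off i j : nat) : bool :=
  match e with
  | Eps => false
  | Sym _ => false
  | Plus a b => followb a off i j || followb b (off + nsym a) i j
  | Cat a b => [|| followb a off i j, followb b (off + nsym a) i j
                 | lastb a off i && firstb b (off + nsym a) j]
  | Star a => followb a off i j || lastb a off i && firstb a off j
  end.

Lemma marked_ex e off : exists w, marked e off w.
Proof.
elim: e off => [|a|a IHa b IHb|a IHa b IHb|a IHa] off.
- by exists [::]; constructor.
- by exists [:: off.+1]; constructor.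
- by have [w ?] := IHa off; exists w; constructor.
- have [w ?] := IHa off; have [v ?] := IHb (off + nsym a).
  by exists (w ++ v); constructor.
- by exists [::]; constructor.
Qed.

Lemma marked_star1 e off w : marked e off w -> marked (Star e) off w.
Proof. by move=> ew; rewrite -[w]cats0; constructor => //; constructor. Qed.

(** Induction on [marked] at the index [Star e] must remember that index; this packages the
    induction on the number of iterations, with the body fixed. *)
Lemma marked_star_ind (P : regex -> nat -> seq nat -> Prop) :
  (forall e off, P e off [::]) ->
  (forall e off w1 w2, marked e off w1 -> marked (Star e) off w2 ->
    P e off w2 -> P e off (w1 ++ w2)) ->
  forall e off w, marked (Star e) off w -> P e off w.
Proof.
move=> P0 PS e off w; move: {-1}(Star e) (erefl (Star e)) => e' e'E m.
elim: m e e'E => // {off w e'} e' off w1 w2 m1 _ m2 IH e e'E.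
by case: e'E m1 m2 IH => -> m1 m2 IH; apply: PS => //; exact: IH.
Qed.

Lemma nullableP e off : nullable e <-> marked e off [::].
Proof.
split.
  elim: e off => //= [|a IHa b IHb|a IHa b IHb|a IHa] off.
  - by constructor.
  - by case/orP => ?; [apply/mPlusL/IHa|apply/mPlusR/IHb].
  - by case/andP => ? ?; rewrite -[[::]]cat0s; constructor; [apply/IHa|apply/IHb].
  - by constructor.
move: {-1}[::] (erefl (Nil nat)) => w wE m.
elim: m wE => {e off w} //= [e1 e2 off w _ IH /IH->//|e1 e2 off w _ IH /IH->|].
  by rewrite orbT.
by move=> e1 e2 off [|//] [|//] _ IH1 _ IH2 _; rewrite IH1 // IH2.
Qed.

Lemma firstbP e off i : firstb e off i <-> exists w, marked e off (i :: w).
Proof.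
split.
  elim: e off => //= [a|a IHa b IHb|a IHa b IHb|a IHa] off.
  - by move/eqP => ->; exists [::]; constructor.
  - case/orP => [/IHa|/IHb] [w m]; exists w; first by constructor.
    exact: mPlusR.
  - case/orP => [/IHa [w m]|/andP[/(nullableP _ off) n /IHb [w m]]].
      have [v mv] := marked_ex b (off + nsym a).
      by exists (w ++ v); rewrite -cat_cons; constructor.
    by exists w; rewrite -[_ :: _]cat0s; constructor.
  - by move/IHa => [w m]; exists w; exact: marked_star1.
case=> w; move: {-1}(i :: w) (erefl (i :: w)) => v vE m.
elim: m w vE => {e off v} //=.
- by move=> _ off w [->]; rewrite eqxx.
- by move=> e1 e2 off w _ IH v wE; rewrite (IH v).
- by move=> e1 e2 off w _ IH v wE; rewrite (IH v) // orbT.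
- move=> e1 e2 off [|k w1] w2 m1 IH1 m2 IH2 w /= wE.
    by rewrite (IH2 w) // (proj2 (nullableP e1 off) m1) orbT.
  by case: wE => ki _; rewrite (IH1 w1) // ki.
- move=> e off [|k w1] w2 _ IH1 _ IH2 w /= wE; first exact: (IH2 w).
  by case: wE => ki _; rewrite (IH1 w1) // ki.
Qed.

Lemma cat_rconsP (T : Type) (w1 w2 w : seq T) i : w1 ++ w2 = rcons w i ->
  (w2 = [::] /\ w1 = rcons w i) \/ exists w', w2 = rcons w' i.
Proof.
case/lastP: w2 => [|w2 k]; first by rewrite cats0; left.
by rewrite -rcons_cat => /rcons_inj [_ ->]; right; exists w2.
Qed.

Lemma lastbP e off i : lastb e off i <-> exists w, marked e off (rcons w i).
Proof.
split.
  elim: e off => //= [a|a IHa b IHb|a IHa b IHb|a IHa] off.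
  - by move/eqP => ->; exists [::]; constructor.
  - case/orP => [/IHa|/IHb] [w m]; exists w; first by constructor.
    exact: mPlusR.
  - case/orP => [/IHb [w m]|/andP[/(nullableP _ (off + nsym a)) n /IHa [w m]]].
      have [v mv] := marked_ex a off.
      by exists (v ++ w); rewrite rcons_cat; constructor.
    by exists w; rewrite -[rcons _ _]cats0; constructor.
  - by move/IHa => [w m]; exists w; exact: marked_star1.
case=> w; move: {-1}(rcons w i) (erefl (rcons w i)) => v vE m.
elim: m w vE => {e off v} //=.
- by move=> off [].
- by move=> _ off [|x [|y w]] //= [->]; rewrite eqxx.
- by move=> e1 e2 off w _ IH v wE; rewrite (IH v).
- by move=> e1 e2 off w _ IH v wE; rewrite (IH v) // orbT.
- move=> e1 e2 off w1 w2 m1 IH1 m2 IH2 w /esym wE; have [[w20 w1E]|[w' w2E]] := cat_rconsP wE.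
    by rewrite (IH1 w) // (proj2 (nullableP e2 (off + nsym e1))) ?orbT // -w20.
  by rewrite (IH2 w').
- by move=> e off [].
- move=> e off w1 w2 m1 IH1 m2 IH2 w /esym wE; have [[w20 w1E]|[w' w2E]] := cat_rconsP wE.
    exact: (IH1 w).
  exact: (IH2 w').
Qed.

Lemma cat_pairP (T : Type) (w1 w2 u v : seq T) i j :
  w1 ++ w2 = u ++ i :: j :: v ->
  [\/ exists v', w1 = u ++ i :: j :: v', w1 = rcons u i /\ w2 = j :: v
    | exists u', w2 = u' ++ i :: j :: v].
Proof.
elim: w1 u => [|k w1 IH] [|k' u] /=.
- by move=> ->; constructor 3; exists [::].
- by move=> ->; constructor 3; exists (k' :: u).
- case: w1 IH => [|k2 w1] IH /= [->]; first by move=> ->; constructor 2.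
  by case=> -> _; constructor 1; exists w1.
- case=> -> /IH [[v' ->]|[-> ->]|[u' ->]].
  + by constructor 1; exists v'.
  + by constructor 2.
  + by constructor 3; exists u'.
Qed.

Lemma followbP e off i j :
  followb e off i j <-> exists u v, marked e off (u ++ i :: j :: v).
Proof.
split.
  elim: e off => //= [a IHa b IHb|a IHa b IHb|a IHa] off.
  - case/orP => [/IHa|/IHb] [u [v m]]; exists u, v; first by constructor.
    exact: mPlusR.
  - case/or3P => [/IHa [u [v m]]|/IHb [u [v m]]|].
    + have [w mw] := marked_ex b (off + nsym a).
      by exists u, (v ++ w); rewrite -!cat_cons catA; constructor.
    + have [w mw] := marked_ex a off.
      by exists (w ++ u), v; rewrite -catA; constructor.
    + case/andP => /lastbP [u mu] /firstbP [v mv]; exists u, v.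
      by rewrite -cat_rcons; constructor.
  - case/orP => [/IHa [u [v m]]|/andP[/lastbP [u mu] /firstbP [v mv]]]; exists u, v.
      exact: marked_star1.
    by rewrite -cat_rcons; constructor => //; exact: marked_star1.
elim: e off => /= [|a|a IHa b IHb|a IHa b IHb|a IHa] off [u [v m]].
- have wE : u ++ i :: j :: v = [::] by inversion m.
  by case: u {m} wE.
- have wE : u ++ i :: j :: v = [:: off.+1] by inversion m.
  by case: u {m} wE => [|x []].
- by inversion m; [rewrite IHa|rewrite IHb ?orbT] => //; exists u, v.
- inversion m as [| | | |e1 e2 o w1 w2 m1 m2 E1 E2 E3| |]; subst.
  have [[v' w1E]|[w1E w2E]|[u' w2E]] := cat_pairP E3; subst.
  + by rewrite IHa //; exists u, v'.
  + rewrite (proj2 (lastbP a off i)); last by exists u.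
    by rewrite (proj2 (firstbP b _ j)) ?orbT //; exists v.
  + by rewrite IHb ?orbT //; exists u', v.
move: {-1}(u ++ i :: j :: v) (erefl (u ++ i :: j :: v)) m => w wE m.
elim/marked_star_ind: {w a off} m u wE IHa => [a off [|? []]//|].
move=> a off w1 w2 m1 m2 IH u w12 IHa.
have [[v' w1E]|[w1E w2E]|[u' w2E]] := cat_pairP (esym w12); subst.
- by rewrite IHa //; exists u, v'.
- apply/orP; right; rewrite (proj2 (lastbP a off i)); last by exists u.
  (* [firstb] of a star is that of its body by computation, so the remaining iterations can be used
     as one word of [Star a]. *)
  by apply/(firstbP (Star a)); exists v.
- exact: (IH u').
Qed.

Lemma nsym_Plus a b : nsym (Plus a b) = nsym a + nsym b.
Proof. exact: size_cat. Qed.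
Lemma nsym_Cat a b : nsym (Cat a b) = nsym a + nsym b.
Proof. exact: size_cat. Qed.

Lemma firstb_range e off i : firstb e off i -> off < i <= off + nsym e.
Proof.
elim: e off => //= [a|a IHa b IHb|a IHa b IHb] off.
- by move/eqP => ->; rewrite /nsym /=; lia.
- by rewrite nsym_Plus => /orP[/IHa|/IHb]; lia.
- by rewrite nsym_Cat => /orP[/IHa|/andP[_ /IHb]]; lia.
Qed.

Lemma lastb_range e off i : lastb e off i -> off < i <= off + nsym e.
Proof.
elim: e off => //= [a|a IHa b IHb|a IHa b IHb] off.
- by move/eqP => ->; rewrite /nsym /=; lia.
- by rewrite nsym_Plus => /orP[/IHa|/IHb]; lia.
- by rewrite nsym_Cat => /orP[/IHb|/andP[_ /IHa]]; lia.
Qed.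

Lemma followb_range e off i j : followb e off i j ->
  (off < i <= off + nsym e) && (off < j <= off + nsym e).
Proof.
elim: e off => //= [a IHa b IHb|a IHa b IHb|a IHa] off.
- by rewrite nsym_Plus => /orP[/IHa|/IHb]; lia.
- rewrite nsym_Cat => /or3P[/IHa|/IHb|/andP[/lastb_range ? /firstb_range]]; lia.
- by case/orP => [/IHa//|/andP[/lastb_range + /firstb_range]]; rewrite /nsym /=; lia.
Qed.

(** * Counting positions and pairs of positions *)

Fixpoint nfirst (e : regex) : nat :=
  match e with
  | Eps => 0
  | Sym _ => 1
  | Plus a b => nfirst a + nfirst b
  | Cat a b => nfirst a + nullable a * nfirst b
  | Star a => nfirst a
  end.

Fixpoint nlast (e : regex) : nat :=
  match e with
  | Eps => 0
  | Sym _ => 1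
  | Plus a b => nlast a + nlast b
  | Cat a b => nlast b + nullable b * nlast a
  | Star a => nlast a
  end.

(* Size of (Last e x First e) minus Follow e: what a star adds to Follow. *)
Fixpoint nextra (e : regex) : nat :=
  match e with
  | Eps => 0
  | Sym _ => 1
  | Plus a b => nextra a + nextra b + nlast a * nfirst b + nlast b * nfirst a
  | Cat a b => nlast b * nfirst a + nullable a * nextra b + nullable b * nextra a
  | Star a => 0
  end.

Fixpoint nfollow (e : regex) : nat :=
  match e with
  | Eps => 0
  | Sym _ => 0
  | Plus a b => nfollow a + nfollow b
  | Cat a b => nfollow a + nfollow b + nlast a * nfirst b
  | Star a => nfollow a + nextra a
  end.

Definition possum (off n : nat) (F : nat -> nat) : nat :=
  \sum_(i <- iota off.+1 n) F i.

Lemma possumD off m n F :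
  possum off (m + n) F = possum off m F + possum (off + m) n F.
Proof. by rewrite /possum iotaD big_cat. Qed.

Lemma eq_possum off n F G :
  (forall i, off < i <= off + n -> F i = G i) -> possum off n F = possum off n G.
Proof.
move=> FG; rewrite /possum; apply: eq_big_seq => i; rewrite mem_iota => ?.
by apply: FG; lia.
Qed.

Lemma possum_add off n F G :
  possum off n (fun i => F i + G i) = possum off n F + possum off n G.
Proof. exact: big_split. Qed.

Lemma possum_mul m n o p (F G : nat -> nat) :
  possum m n (fun i => possum o p (fun j => F i * G j)) =
  possum m n F * possum o p G.
Proof.
rewrite /possum big_distrlr /=.
by [].
Qed.

Lemma possum_mull off n c F : possum off n (fun i => c * F i) = c * possum off n F.
Proof. by rewrite /possum big_distrr. Qed.

Lemma firstb_false e off i : ~~ (off < i <= off + nsym e) -> firstb e off i = false.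
Proof. by apply: contraNF => /firstb_range. Qed.
Lemma lastb_false e off i : ~~ (off < i <= off + nsym e) -> lastb e off i = false.
Proof. by apply: contraNF => /lastb_range. Qed.
Lemma followb_falsel e off i j :
  ~~ (off < i <= off + nsym e) -> followb e off i j = false.
Proof. by apply: contraNF => /followb_range/andP[]. Qed.
Lemma followb_falser e off i j :
  ~~ (off < j <= off + nsym e) -> followb e off i j = false.
Proof. by apply: contraNF => /followb_range/andP[]. Qed.

Lemma possum_first e off : possum off (nsym e) (firstb e off) = nfirst e.
Proof.
elim: e off => //= [|a|a IHa b IHb|a IHa b IHb] off.
- exact: big_nil.
- by rewrite /possum big_seq1 eqxx.
- rewrite nsym_Plus possumD -(IHa off) -(IHb (off + nsym a)).
  congr (_ + _); apply: eq_possum => i ir.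
    by rewrite (@firstb_false b) ?orbF //; lia.
  by rewrite (@firstb_false a) //; lia.
- rewrite nsym_Cat possumD -(IHa off) -(IHb (off + nsym a)) -possum_mull.
  congr (_ + _); apply: eq_possum => i ir.
    by rewrite (@firstb_false b) ?andbF ?orbF //; lia.
  by rewrite (@firstb_false a) ?mulnb //; lia.
Qed.

Lemma possum_last e off : possum off (nsym e) (lastb e off) = nlast e.
Proof.
elim: e off => //= [|a|a IHa b IHb|a IHa b IHb] off.
- exact: big_nil.
- by rewrite /possum big_seq1 eqxx.
- rewrite nsym_Plus possumD -(IHa off) -(IHb (off + nsym a)).
  congr (_ + _); apply: eq_possum => i ir.
    by rewrite (@lastb_false b) ?orbF //; lia.
  by rewrite (@lastb_false a) //; lia.
- rewrite nsym_Cat possumD -(IHa off) -(IHb (off + nsym a)) -possum_mull addnC.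
  congr (_ + _); apply: eq_possum => i ir.
    by rewrite (@lastb_false a) ?andbF ?orbF //; lia.
  by rewrite (@lastb_false b) ?mulnb //; lia.
Qed.

Definition extrab e off i j :=
  [&& lastb e off i, firstb e off j & ~~ followb e off i j].

Lemma possum2D off m n (F : nat -> nat -> nat) :
  possum off (m + n) (fun i => possum off (m + n) (F i)) =
  possum off m (fun i => possum off m (F i))
  + possum off m (fun i => possum (off + m) n (F i))
  + (possum (off + m) n (fun i => possum off m (F i))
  + possum (off + m) n (fun i => possum (off + m) n (F i))).
Proof.
rewrite possumD -!possum_add.
by congr (_ + _); apply: eq_possum => i _; rewrite possumD.
Qed.

Lemma eq_possum2 off n off' n' F G :
  (forall i j, off < i <= off + n -> off' < j <= off' + n' -> F i j = G i j) ->
  possum off n (fun i => possum off' n' (F i)) =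
  possum off n (fun i => possum off' n' (G i)).
Proof. by move=> FG; apply: eq_possum => i ?; apply: eq_possum => j ?; exact: FG. Qed.

Lemma possum2_0 off n off' n' : possum off n (fun i => possum off' n' (fun _ => 0)) = 0.
Proof. by rewrite /possum big1 // => i _; rewrite big1. Qed.

Lemma possum2_mull off n off' n' c F :
  possum off n (fun i => possum off' n' (fun j => c * F i j)) =
  c * possum off n (fun i => possum off' n' (F i)).
Proof. by rewrite -possum_mull; apply: eq_possum => i _; rewrite possum_mull. Qed.

(** The pairs split into four blocks according to the operand of each position. In a concatenation,
    all pairs of Last a x First b are in Follow, so that block is empty, and no pair of Last b x
    First a is; the diagonal blocks survive only if the other operand is nullable. A star puts all
    of Last x First into Follow. *)
Lemma possum_extra e off :
  possum off (nsym e) (fun i => possum off (nsym e) (extrab e off i)) = nextra e.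
Proof.
have addn4 A B C D : A + B + (C + D) = A + D + B + C by lia.
elim: e off => //= [|a|a IHa b IHb|a IHa b IHb|a IHa] off.
- exact: big_nil.
- by rewrite /possum !big_seq1 /extrab /= eqxx.
- rewrite nsym_Plus possum2D /= -(IHa off) -(IHb (off + nsym a)).
  rewrite -(possum_last a off) -(possum_first b (off + nsym a)).
  rewrite -(possum_last b (off + nsym a)) -(possum_first a off) -!possum_mul addn4.
  congr (_ + _ + _ + _); apply: eq_possum2 => i j ir jr; rewrite /extrab /=.
  + rewrite (@firstb_false b) ?(@lastb_false b) ?(@followb_falsel b) ?orbF //; lia.
  + rewrite (@firstb_false a) ?(@lastb_false a) ?(@followb_falsel a) //; lia.
  + rewrite (@firstb_false a) ?(@lastb_false b) ?(@followb_falsel b) ?(@followb_falser a)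
      ?orbF ?andbT ?mulnb //; lia.
  + rewrite (@firstb_false b) ?(@lastb_false a) ?(@followb_falsel a) ?(@followb_falser b)
      ?orbF ?andbT ?mulnb //; lia.
- rewrite nsym_Cat possum2D /= -(IHa off) -(IHb (off + nsym a)).
  rewrite -(possum_last b (off + nsym a)) -(possum_first a off) -!possum_mul.
  rewrite -!possum2_mull.
  have addn4' A B C D x y z : A = x -> B = 0 -> C = y -> D = z ->
    A + B + (C + D) = y + z + x by lia.
  apply: addn4'.
  + apply: eq_possum2 => i j ir jr; rewrite /extrab /=.
    rewrite (@firstb_false b) ?(@lastb_false b) ?(@followb_falsel b) ?andbF ?orbF ?mulnb ?andbA //; lia.
  + rewrite -[RHS](possum2_0 off (nsym a) (off + nsym a) (nsym b)).
    apply: eq_possum2 => i j ir jr; rewrite /extrab /=.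
    rewrite (@firstb_false a) ?(@lastb_false b) ?(@followb_falsel b) ?(@followb_falser a) //=; try lia.
  + apply: eq_possum2 => i j ir jr; rewrite /extrab /=.
    rewrite (@firstb_false b) ?(@lastb_false a) ?(@followb_falsel a) ?(@followb_falser b)
      ?andbF ?orbF ?andbT ?mulnb //; lia.
  + apply: eq_possum2 => i j ir jr; rewrite /extrab /=.
    rewrite (@firstb_false a) ?(@lastb_false a) ?(@followb_falsel a) ?andbF ?orbF ?mulnb //=; try lia.
- rewrite -[RHS](possum2_0 off (nsym a) off (nsym a)); apply: eq_possum2 => i j _ _.
  by rewrite /extrab /=; case: lastb; case: firstb; case: followb => //.
Qed.

Lemma possum_follow e off :
  possum off (nsym e) (fun i => possum off (nsym e) (followb e off i)) = nfollow e.
Proof.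
have addn4' A B C D x y : A = x -> D = y -> B = 0 -> C = 0 -> A + B + (C + D) = x + y by lia.
have addn4 A B C D : A + B + (C + D) = A + D + B + C by lia.
elim: e off => //= [|a|a IHa b IHb|a IHa b IHb|a IHa] off.
- exact: big_nil.
- by rewrite /possum !big_seq1.
- rewrite nsym_Plus possum2D /= -(IHa off) -(IHb (off + nsym a)).
  apply: addn4'; last rewrite -[RHS](possum2_0 (off + nsym a) (nsym b) off (nsym a)).
  + apply: eq_possum2 => i j ir jr; rewrite (@followb_falsel b) ?orbF //; lia.
  + apply: eq_possum2 => i j ir jr; rewrite (@followb_falsel a) //; lia.
  + rewrite -[RHS](possum2_0 off (nsym a) (off + nsym a) (nsym b)).
    apply: eq_possum2 => i j ir jr.
    rewrite (@followb_falsel b) ?(@followb_falser a) //; lia.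
  + apply: eq_possum2 => i j ir jr.
    rewrite (@followb_falsel a) ?(@followb_falser b) //; lia.
- rewrite nsym_Cat possum2D /= -(IHa off) -(IHb (off + nsym a)) addn4.
  rewrite -(possum_last a off) -(possum_first b (off + nsym a)) -!possum_mul.
  rewrite -[RHS]addn0; congr (_ + _ + _ + _).
  + apply: eq_possum2 => i j ir jr.
    rewrite (@followb_falsel b) ?(@firstb_false b) ?andbF ?orbF //; lia.
  + apply: eq_possum2 => i j ir jr.
    rewrite (@followb_falsel a) ?(@lastb_false a) ?orbF //; lia.
  + apply: eq_possum2 => i j ir jr.
    rewrite (@followb_falsel b) ?(@followb_falser a) ?mulnb //; lia.
  + rewrite -[RHS](possum2_0 (off + nsym a) (nsym b) off (nsym a)).
    apply: eq_possum2 => i j ir jr.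
    rewrite (@followb_falsel a) ?(@followb_falser b) ?(@firstb_false b) ?andbF //; lia.
- rewrite -(IHa off) -(possum_extra a off) -possum_add; apply: eq_possum => i _.
  rewrite -possum_add; apply: eq_possum => j _; rewrite /extrab.
  by case: followb; case: lastb; case: firstb.
Qed.

Lemma ind_bool (P : Prop) (b : bool) : (b <-> P) -> ind P = b.
Proof.
rewrite /ind => bP; case: ClassicalEpsilon.excluded_middle_informative => [/bP->//|nP].
by case: b bP => // [[]] /(_ isT).
Qed.

Lemma glushkov_transitionsE e : glushkov_transitions e = nfirst e + nfollow e.
Proof.
rewrite -(possum_first e 0) -(possum_follow e 0) /glushkov_transitions /possum.
rewrite /index_iota subSS subn0; congr (_ + _); apply: eq_bigr => i _.
  by apply: ind_bool; exact: firstbP.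
by apply: eq_bigr => j _; apply: ind_bool; exact: followbP.
Qed.

Import Order.TTheory GRing.Theory Num.Theory.
Import numFieldNormedType.Exports.
Local Open Scope classical_set_scope.
Local Open Scope ring_scope.

(** * Formal power series *)

(** A named copy of [nat -> A], so that its product is the Cauchy product and not the pointwise
    one. *)
Definition fps (A : Type) : Type := nat -> A.
Definition fcoef (A : Type) (a : fps A) (n : nat) : A := a n.
Notation "a $ n" := (fcoef a n) (at level 3, n at level 2, format "a $ n").

HB.instance Definition _ (A : Type) := gen_eqMixin (fps A).
HB.instance Definition _ (A : Type) := gen_choiceMixin (fps A).

Lemma fpsP (A : Type) (a b : fps A) : (forall n, a$n = b$n) -> a = b.
Proof. by move=> ab; apply/funext. Qed.

Section FpsZmod.
Variable A : zmodType.
Implicit Types a b c : fps A.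
Let fps0 : fps A := fun=> 0.
Let fadd a b : fps A := fun n => a$n + b$n.
Let fopp a : fps A := fun n => - a$n.
Let faddA : associative fadd.
Proof. by move=> a b c; apply/fpsP => n; exact: addrA. Qed.
Let faddC : commutative fadd.
Proof. by move=> a b; apply/fpsP => n; exact: addrC. Qed.
Let fadd0 : left_id fps0 fadd.
Proof. by move=> a; apply/fpsP => n; exact: add0r. Qed.
Let faddN : left_inverse fps0 fopp fadd.
Proof. by move=> a; apply/fpsP => n; exact: addNr. Qed.
HB.instance Definition _ := GRing.isZmodule.Build (fps A) faddA faddC fadd0 faddN.
Lemma fcoef0 n : (0 : fps A)$n = 0. Proof. by []. Qed.
Lemma fcoefD a b n : (a + b)$n = a$n + b$n. Proof. by []. Qed.
Lemma fcoefN a n : (- a)$n = - a$n. Proof. by []. Qed.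
Lemma fcoefB a b n : (a - b)$n = a$n - b$n. Proof. by []. Qed.
Lemma fcoef_sum I (r : seq I) (P : pred I) (F : I -> fps A) n :
  (\sum_(i <- r | P i) F i)$n = \sum_(i <- r | P i) (F i)$n.
Proof. by elim/big_rec2: _ => [//|i y1 y2 _]; rewrite fcoefD => ->. Qed.
End FpsZmod.

Section FpsRing.
Variable A : comNzRingType.
Implicit Types a b : fps A.
Let fone : fps A := fun n => (n == 0%N)%:R.
Definition fmul a b : fps A := fun n => \sum_(i < n.+1) a$i * b$(n - i)%N.
Definition ftrunc N a : {poly A} := \poly_(i < N) a$i.

Lemma coef_ftrunc N a n : (n < N)%N -> (ftrunc N a)`_n = a$n.
Proof. by move=> nN; rewrite coef_poly nN. Qed.

(** A coefficient only sees truncations, so associativity and commutativity are inherited from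
    polynomials. *)
Let fmulE N a b n : (n < N)%N -> fmul a b n = (ftrunc N a * ftrunc N b)`_n.
Proof.
move=> nN; rewrite coefM; apply: eq_bigr => i _.
by rewrite !coef_ftrunc //; have := ltn_ord i; lia.
Qed.
Let fmulA : associative fmul.
Proof.
move=> a b c; apply/fpsP => n.
transitivity (ftrunc n.+1 a * (ftrunc n.+1 b * ftrunc n.+1 c))`_n.
  rewrite coefM; apply: eq_bigr => i _.
  rewrite coef_ftrunc; last by have := ltn_ord i; lia.
  by congr (_ * _); rewrite /fcoef (@fmulE n.+1) //; lia.
rewrite mulrA coefM; apply: eq_bigr => i _.
rewrite coef_ftrunc; last by lia.
by congr (_ * _); rewrite [RHS]/fcoef (@fmulE n.+1) //; lia.
Qed.
Let fmulC : commutative fmul.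
Proof.
by move=> a b; apply/fpsP => n; rewrite /fcoef !(@fmulE n.+1) // mulrC.
Qed.
Let fmul1 : left_id fone fmul.
Proof.
move=> a; apply/fpsP => n; rewrite /fcoef /fmul big_ord_recl /= subn0.
by rewrite big1 ?addr0 ?mul1r // => i _; rewrite {1}/fcoef /= mul0r.
Qed.
Let fmulDl : left_distributive fmul +%R.
Proof.
move=> a b c; apply/fpsP => n; rewrite fcoefD /fcoef /fmul -big_split /=.
by apply: eq_bigr => i _; rewrite fcoefD mulrDl.
Qed.
Let fone_neq0 : fone != 0.
Proof.
apply/eqP => /(congr1 (fun a : fps A => a$0)).
by rewrite fcoef0 /fcoef /= => /eqP; rewrite oner_eq0.
Qed.
HB.instance Definition _ :=
  GRing.Zmodule_isComNzRing.Build (fps A) fmulA fmulC fmul1 fmulDl fone_neq0.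

Lemma fcoef1 n : (1 : fps A)$n = (n == 0%N)%:R. Proof. by []. Qed.
Lemma fcoefM a b n : (a * b)$n = \sum_(i < n.+1) a$i * b$(n - i)%N.
Proof. by []. Qed.
Lemma fcoefM0 a b : (a * b)$0 = a$0 * b$0.
Proof. by rewrite fcoefM big_ord_recl big_ord0 addr0. Qed.
Lemma fcoefM_trunc N a b n : (n < N)%N ->
  (a * b)$n = (ftrunc N a * ftrunc N b)`_n.
Proof. exact: fmulE. Qed.

Definition pfps (p : {poly A}) : fps A := fun n => p`_n.
Lemma fcoef_pfps p n : (pfps p)$n = p`_n. Proof. by []. Qed.
Lemma pfps_is_additive : additive pfps.
Proof. by move=> p q; apply/fpsP => n; rewrite fcoefB !fcoef_pfps coefB. Qed.
HB.instance Definition _ := GRing.isAdditive.Build _ _ pfps pfps_is_additive.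
Lemma pfps_is_multiplicative : multiplicative pfps.
Proof.
split=> [p q|]; apply/fpsP => n; last by rewrite fcoef_pfps coef1.
by rewrite fcoef_pfps coefM fcoefM.
Qed.
HB.instance Definition _ := GRing.isMultiplicative.Build _ _ pfps pfps_is_multiplicative.

Definition fX := pfps 'X.
Definition fC (c : A) := pfps c%:P.
Lemma fcoefX n : fX$n = (n == 1%N)%:R. Proof. by rewrite fcoef_pfps coefX. Qed.
Lemma fcoefC c n : (fC c)$n = if n == 0%N then c else 0.
Proof. by rewrite fcoef_pfps coefC. Qed.
Lemma fcoefCM c a n : (fC c * a)$n = c * a$n.
Proof.
rewrite fcoefM big_ord_recl /= fcoefC subn0 big1 ?addr0 // => i _.
by rewrite fcoefC mul0r.
Qed.
Lemma fcoefXM a n : (fX * a)$n = if n is m.+1 then a$m else 0.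
Proof.
case: n => [|n]; first by rewrite fcoefM0 fcoefX mul0r.
rewrite fcoefM big_ord_recl fcoefX mul0r add0r big_ord_recl fcoefX mul1r /=.
rewrite big1 ?addr0 => [|i _]; last by rewrite fcoefX mul0r.
by congr (_ $ _); rewrite /bump /=; lia.
Qed.
Lemma fcoefXXM a m n : (fX ^+ m * a)$n = if (n < m)%N then 0 else a$(n - m)%N.
Proof.
elim: m n => [|m IH] n; first by rewrite mul1r subn0.
by rewrite exprS -mulrA fcoefXM; case: n => [//|n]; rewrite IH ltnS subSS.
Qed.
Lemma fcoefXX m n : (fX ^+ m)$n = (n == m)%:R.
Proof.
rewrite -[_ ^+ _]mulr1 fcoefXXM fcoef1; case: ltngtP => // [mn|->].
  by rewrite gtn_eqF ?subn_gt0.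
by rewrite subnn.
Qed.
Lemma fC_nat n : fC n%:R = n%:R. Proof. by rewrite /fC polyC_natr rmorph_nat. Qed.
Lemma fCM c d : fC (c * d) = fC c * fC d. Proof. by rewrite /fC polyCM rmorphM. Qed.

(** The series a(cz). It moves the dominant singularity to 1, and dilates (1 - z)^(-1/2) to the
    other roots. *)
Definition fscale (c : A) a : fps A := fun n => c ^+ n * a$n.
Lemma fcoef_scale c a n : (fscale c a)$n = c ^+ n * a$n. Proof. by []. Qed.
Section Scale.
Variable c : A.
Lemma fscale_is_additive : additive (fscale c).
Proof. by move=> p q; apply/fpsP => n; rewrite fcoefB !fcoef_scale mulrBr. Qed.
HB.instance Definition _ := GRing.isAdditive.Build _ _ (fscale c) fscale_is_additive.
Lemma fscale_is_multiplicative : multiplicative (fscale c).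
Proof.
split=> [p q|]; apply/fpsP => n.
  rewrite fcoef_scale !fcoefM mulr_sumr; apply: eq_bigr => i _.
  rewrite !fcoef_scale mulrACA -exprD; congr (_ ^+ _ * _).
  by rewrite subnKC // -ltnS.
by rewrite fcoef_scale !fcoef1; case: n => [|n]; rewrite ?mul1r ?mulr0.
Qed.
HB.instance Definition _ := GRing.isMultiplicative.Build _ _ (fscale c) fscale_is_multiplicative.
Lemma fscaleX : fscale c fX = fC c * fX.
Proof.
apply/fpsP => n; rewrite fcoef_scale fcoefCM !fcoefX.
by case: eqP => [->|]; rewrite ?mulr0 ?mulr1.
Qed.
Lemma fscaleC d : fscale c (fC d) = fC d.
Proof.
by apply/fpsP => n; rewrite fcoef_scale fcoefC; case: n => [|n] /=; rewrite ?mul1r ?mulr0.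
Qed.
End Scale.

Definition ftheta a : fps A := fun n => n%:R * a$n.
Lemma fcoef_theta a n : (ftheta a)$n = n%:R * a$n. Proof. by []. Qed.
Lemma ftheta_is_additive : additive ftheta.
Proof. by move=> p q; apply/fpsP => n; rewrite fcoefB !fcoef_theta mulrBr. Qed.
HB.instance Definition _ := GRing.isAdditive.Build _ _ ftheta ftheta_is_additive.
Lemma fthetaM a b : ftheta (a * b) = ftheta a * b + a * ftheta b.
Proof.
apply/fpsP => n; rewrite fcoefD fcoef_theta !fcoefM -big_split mulr_sumr.
apply: eq_bigr => i _; rewrite !fcoef_theta.
have -> : n%:R = i%:R + (n - i)%:R :> A by rewrite -natrD subnKC // -ltnS.
by rewrite /=; ring.
Qed.
Lemma fthetaX : ftheta fX = fX.
Proof.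
apply/fpsP => n; rewrite fcoef_theta fcoefX.
by case: eqP => [->|]; rewrite ?mulr0 ?mulr1.
Qed.
Lemma fthetaXX m : ftheta (fX ^+ m) = m%:R * fX ^+ m.
Proof.
apply/fpsP => n; rewrite fcoef_theta -fC_nat fcoefCM !fcoefXX.
by case: eqP => [->|]; rewrite ?mulr0 ?mulr1.
Qed.
Lemma fthetaC c : ftheta (fC c) = 0.
Proof.
apply/fpsP => n; rewrite fcoef_theta fcoefC fcoef0.
by case: n => [|n] /=; rewrite ?mul0r ?mulr0.
Qed.
Lemma ftheta_nat n : ftheta n%:R = 0.
Proof. by rewrite -fC_nat fthetaC. Qed.
Lemma ftheta1 : ftheta 1 = 0. Proof. exact: (ftheta_nat 1). Qed.

Lemma fcoef_exp_lt u m n : u$0 = 0 -> (n < m)%N -> (u ^+ m)$n = 0.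
Proof.
move=> u0; elim: m n => [//|m IH] n nm.
rewrite exprS fcoefM big_ord_recl u0 mul0r add0r big1 // => i _.
by rewrite IH ?mulr0 // lift0 /=; have := ltn_ord i; lia.
Qed.

(** The inverse of 1 - u when u has no constant term: powers beyond the n-th do not reach
    coefficient n. In this form it visibly inherits nonnegativity from u. *)
Definition finv1 u : fps A := fun n => (\sum_(j < n.+1) u ^+ j)$n.
Lemma fcoef_inv1 u N n : u$0 = 0 -> (n < N)%N ->
  (finv1 u)$n = (\sum_(j < N) u ^+ j)$n.
Proof.
move=> u0 nN; have -> : (finv1 u)$n = (\sum_(j < n.+1) u ^+ j)$n by [].
rewrite !fcoef_sum.
rewrite -!(big_mkord xpredT (fun j => (u ^+ j)$n)).
rewrite [RHS](big_cat_nat (n := n.+1)) //= [X in _ = _ + X]big1_seq ?addr0 // => j.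
by rewrite mem_index_iota => /andP[_ /andP[nj _]]; apply: fcoef_exp_lt.
Qed.
Lemma finv1E u : u$0 = 0 -> finv1 u = 1 + u * finv1 u.
Proof.
move=> u0; apply/fpsP => n.
rewrite fcoefD (@fcoef_inv1 _ n.+2) // big_ord_recl fcoefD; congr (_ + _).
transitivity ((u * \sum_(j < n.+1) u ^+ j)$n).
  by rewrite mulr_sumr; congr (_ $ _); apply: eq_bigr => i _; rewrite exprS.
rewrite !fcoefM; apply: eq_bigr => i _; rewrite (@fcoef_inv1 _ n.+1) //; have := ltn_ord i; lia.
Qed.

End FpsRing.
Arguments fX {A}.

Section FpsMap.
Variables (A B : comNzRingType) (f : {rmorphism A -> B}).
Definition fmap (a : fps A) : fps B := fun n => f (a$n).
Lemma fcoef_map a n : (fmap a)$n = f (a$n). Proof. by []. Qed.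
Lemma fmap_is_additive : additive fmap.
Proof. by move=> p q; apply/fpsP => n; rewrite fcoefB !fcoef_map rmorphB. Qed.
HB.instance Definition _ := GRing.isAdditive.Build _ _ fmap fmap_is_additive.
Lemma fmap_is_multiplicative : multiplicative fmap.
Proof.
split=> [p q|]; apply/fpsP => n; rewrite fcoef_map; last by rewrite !fcoef1 rmorph_nat.
rewrite !fcoefM rmorph_sum; apply: eq_bigr => i _.
by rewrite rmorphM.
Qed.
HB.instance Definition _ := GRing.isMultiplicative.Build _ _ fmap fmap_is_multiplicative.
Lemma fmap_pfps p : fmap (pfps p) = pfps (map_poly f p).
Proof. by apply/fpsP => n; rewrite fcoef_map !fcoef_pfps coef_map. Qed.
End FpsMap.

Section FpsIdomain.
Variable A : idomainType.
Implicit Types a b c : fps A.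
Lemma fmul_eq0 a c : a * c = 0 -> c$0 != 0 -> a = 0.
Proof.
move=> ac0 c0; apply/fpsP => n; elim/ltn_ind: n => n IH.
have := congr1 (fun b : fps A => b$n) ac0; rewrite fcoefM fcoef0 big_ord_recr /=.
rewrite big1 => [|i _]; last by rewrite IH ?mul0r.
by rewrite add0r subnn => /eqP; rewrite mulf_eq0 (negbTE c0) orbF => /eqP ->.
Qed.
Lemma fmulIr a b c : a * c = b * c -> c$0 != 0 -> a = b.
Proof.
by move=> abc c0; apply/subr0_eq/(@fmul_eq0 _ c) => //; rewrite mulrBl abc subrr.
Qed.
Lemma fsqrt_uniq a b : a ^+ 2 = b ^+ 2 -> a$0 + b$0 != 0 -> a = b.
Proof.
move=> ab ab0; apply/subr0_eq/(@fmul_eq0 _ (a + b)) => //.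
by rewrite -subr_sqr ab subrr.
Qed.
End FpsIdomain.

(** * Generating functions *)

HB.instance Definition _ := gen_eqMixin regex.

Lemma enum_aux_fuel k m m' n : (n <= m)%N -> (n <= m')%N ->
  enum_aux k m n = enum_aux k m' n.
Proof.
elim: m m' n => [|m IH] [|m'] [|[|n]] //= nm nm'.
rewrite (IH m') //; congr (_ ++ (flatten _ ++ flatten _));
  apply/eq_in_map => i; rewrite mem_iota => ir.
all: by rewrite (IH m' i) ?(IH m' (n.+1 - i)%N) //; lia.
Qed.

Lemma enum_aux_SS k m n : enum_aux k m.+1 n.+2 =
  map Star (enum_aux k m n.+1)
  ++ flatten [seq [seq Plus e1 e2 | e1 <- enum_aux k m i, e2 <- enum_aux k m (n.+1 - i)]
             | i <- iota 1 n]
  ++ flatten [seq [seq Cat e1 e2 | e1 <- enum_aux k m i, e2 <- enum_aux k m (n.+1 - i)]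
             | i <- iota 1 n].
Proof. by []. Qed.

Lemma enum_re_SS k n : enum_re k n.+2 =
  map Star (enum_re k n.+1)
  ++ flatten [seq [seq Plus e1 e2 | e1 <- enum_re k i, e2 <- enum_re k (n.+1 - i)]
             | i <- iota 1 n]
  ++ flatten [seq [seq Cat e1 e2 | e1 <- enum_re k i, e2 <- enum_re k (n.+1 - i)]
             | i <- iota 1 n].
Proof.
rewrite /enum_re enum_aux_SS; congr (_ ++ (flatten _ ++ flatten _));
  apply/eq_in_map => i; rewrite mem_iota => ir.
all: by rewrite (@enum_aux_fuel k n.+1 i i) ?(@enum_aux_fuel k n.+1 (n.+1 - i)%N (n.+1 - i)%N) //; lia.
Qed.

Lemma size_enum_re k n e : e \in enum_re k n -> re_size e = n.
Proof.
elim/ltn_ind: n e => [[|[|n]]] IH e //.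
  by rewrite inE => /orP[/eqP->//|/mapP[a _ ->]].
rewrite enum_re_SS !mem_cat => /or3P[/mapP[e' /IH <- // ->//]| |].
all: case/flatten_mapP => i; rewrite mem_iota => ir /allpairsP[[e1 e2] /= [m1 m2 ->]].
all: by rewrite /= (IH i) ?(IH (n.+1 - i)%N) //; lia.
Qed.

Section GenFun.
Variables (A : comNzRingType) (k : nat).
Implicit Types phi : regex -> A.

Definition gf phi : fps A := fun n => \sum_(e <- enum_re k n | re_na k e) phi e.
Definition gf2 (psi : regex -> regex -> A) : fps A := fun n =>
  \sum_(i < n.+1) \sum_(e1 <- enum_re k i | re_na k e1)
    \sum_(e2 <- enum_re k (n - i) | re_na k e2) psi e1 e2.

Lemma fcoef_gf phi n : (gf phi)$n = \sum_(e <- enum_re k n | re_na k e) phi e.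
Proof. by []. Qed.
Lemma fcoef_gf2 psi n : (gf2 psi)$n =
  \sum_(i < n.+1) \sum_(e1 <- enum_re k i | re_na k e1)
    \sum_(e2 <- enum_re k (n - i) | re_na k e2) psi e1 e2.
Proof. by []. Qed.

Lemma eq_gf phi phi' : (forall e, phi e = phi' e) -> gf phi = gf phi'.
Proof. by move=> E; apply/fpsP => n; apply: eq_bigr => e _; exact: E. Qed.
Lemma gfD phi phi' : gf (fun e => phi e + phi' e) = gf phi + gf phi'.
Proof. by apply/fpsP => n; rewrite fcoefD !fcoef_gf big_split. Qed.
Lemma gfB phi phi' : gf (fun e => phi e - phi' e) = gf phi - gf phi'.
Proof. by apply/fpsP => n; rewrite fcoefB !fcoef_gf sumrB. Qed.
Lemma gf0 : gf (fun=> 0) = 0.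
Proof. by apply/fpsP => n; rewrite fcoef_gf big1. Qed.
Lemma gfZ c phi : gf (fun e => c * phi e) = fC c * gf phi.
Proof. by apply/fpsP => n; rewrite fcoefCM !fcoef_gf mulr_sumr. Qed.

Lemma eq_gf2 psi psi' : (forall a b, psi a b = psi' a b) -> gf2 psi = gf2 psi'.
Proof.
move=> E; apply/fpsP => n; apply: eq_bigr => i _; apply: eq_bigr => a _.
by apply: eq_bigr => b _.
Qed.
Lemma gf2D psi psi' : gf2 (fun a b => psi a b + psi' a b) = gf2 psi + gf2 psi'.
Proof.
apply/fpsP => n; rewrite fcoefD !fcoef_gf2 -big_split; apply: eq_bigr => i _ /=.
by rewrite -big_split; apply: eq_bigr => a _ /=; rewrite -big_split.
Qed.
Lemma gf2M phi phi' : gf2 (fun a b => phi a * phi' b) = gf phi * gf phi'.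
Proof.
apply/fpsP => n; rewrite fcoefM fcoef_gf2; apply: eq_bigr => i _.
by rewrite !fcoef_gf big_distrlr.
Qed.
Lemma gf2_0 : gf2 (fun _ _ => 0) = 0.
Proof.
transitivity (gf (fun=> 0) * gf (fun=> 0)); last by rewrite gf0 mul0r.
by rewrite -gf2M; apply: eq_gf2 => a b; rewrite mul0r.
Qed.

Lemma fcoef_gf_0 phi : (gf phi)$0 = 0.
Proof. by rewrite fcoef_gf big_nil. Qed.

Definition nonsig e : A := (~~ sigma_star k e)%:R.

(** The only use of the enumeration: every equation below is this decomposition for some weight
    [phi]. The restriction on unions becomes the weight [nonsig a * nonsig b]. *)
Lemma gf_rec phi : gf phi = fX *
  (fC (phi Eps + \sum_(a < k) phi (Sym a)) + gf (fun e => phi (Star e))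
   + gf2 (fun a b => nonsig a * nonsig b * phi (Plus a b))
   + gf2 (fun a b => phi (Cat a b))).
Proof.
apply/fpsP => -[|n]; rewrite fcoefXM ?fcoef_gf_0 //.
case: n => [|n]; rewrite !fcoefD fcoefC /=.
  rewrite fcoef_gf_0 !fcoef_gf2 !big_ord1 !big_nil !addr0 fcoef_gf /enum_re /=.
  rewrite big_cons /= big_map -(big_mkord xpredT (fun a => phi (Sym a))).
  by rewrite /index_iota subn0.
rewrite add0r fcoef_gf enum_re_SS !big_cat /= big_map addrA.
have H (c : regex -> regex -> regex) (psi : regex -> regex -> A) :
  (forall a b, (if re_na k (c a b) then phi (c a b) else 0) =
     if re_na k a then if re_na k b then psi a b else 0 else 0) ->
  \sum_(e <- flatten [seq [seq c e1 e2 | e1 <- enum_re k i,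
     e2 <- enum_re k (n.+1 - i)] | i <- iota 1 n] | re_na k e) phi e = (gf2 psi)$n.+1.
  move=> E; rewrite big_flatten big_map fcoef_gf2.
  rewrite -(big_mkord xpredT (fun i => \sum_(e1 <- enum_re k i | re_na k e1)
    \sum_(e2 <- enum_re k (n.+1 - i) | re_na k e2) psi e1 e2)).
  (* No expression has size 0, so both extreme terms of the Cauchy product vanish and the range
     [iota 1 n] of the enumeration remains. *)
  rewrite big_nat_recr //= subnn /= [X in _ = _ + X]big1 ?addr0; last first.
    by move=> e _; rewrite big_nil.
  rewrite big_ltn // big_nil add0r /index_iota subn1 /=.
  apply: eq_bigr => i _; rewrite big_mkcond big_allpairs_dep [RHS]big_mkcond.
  apply: eq_bigr => a _.
  under eq_bigr do rewrite E.
  by case: (re_na k a); [rewrite -big_mkcond|rewrite big1].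
congr (_ + _ + _); apply: H => a b /=.
- rewrite /nonsig; case: (sigma_star k a) => /=; rewrite ?mul0r ?mul1r.
    by case: re_na; case: re_na.
  case: (sigma_star k b) => /=; rewrite ?mul0r ?mul1r; first by case: re_na; case: re_na.
  by case: re_na; case: re_na.
- by case: re_na; case: re_na.
Qed.

Definition Rgf := gf (fun=> 1).
Definition Mgf := gf (fun e => (~~ nullable e)%:R).
Definition Fgf := gf (fun e => (nfirst e)%:R).
Definition Lgf := gf (fun e => (nlast e)%:R).
Definition Xgf := gf (fun e => (nextra e)%:R).
Definition Egf := gf (fun e => (nfollow e)%:R).
Definition Sgf := gf (fun e => (sigma_star k e)%:R).
Definition tau e := sigma_star k (Star e).

Lemma nonsigE e : nonsig e = 1 - (sigma_star k e)%:R.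
Proof. by rewrite /nonsig; case: sigma_star; rewrite /= ?subrr ?subr0. Qed.

(** In a union of letters every position is both first and last and nothing follows anything, so the
    extra pairs are all pairs. *)
Lemma union_of_symsP e : union_of_syms e ->
  [/\ nfirst e = nsym e, nlast e = nsym e, nextra e = (nsym e ^ 2)%N, nfollow e = 0%N
    & re_size e = (2 * nsym e).-1 /\ (0 < nsym e)%N].
Proof.
elim: e => //= a IHa b IHb /andP[/IHa[fa la xa ea [sa pa]] /IHb[fb lb xb eb [sb pb]]].
rewrite nsym_Plus fa la xa ea fb lb xb eb; split=> //; last by split; lia.
by rewrite !expnS expn0; lia.
Qed.

Lemma tauP e : tau e -> [/\ nfirst e = k, nlast e = k, nextra e = (k ^ 2)%N,
  nfollow e = 0%N & re_size e = (2 * k).-1 /\ (0 < k)%N].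
Proof.
by case/andP => /union_of_symsP H /perm_size; rewrite size_iota => <-.
Qed.

Lemma gf_sig phi c : (forall e, tau e -> phi (Star e) = c) ->
  gf (fun e => (sigma_star k e)%:R * phi e) = fC c * Sgf.
Proof.
move=> H; rewrite -gfZ; apply: eq_gf => e; rewrite [RHS]mulrC.
case: e => [|a|a b|a b|e]; rewrite ?mul0r //.
by case te: (sigma_star k (Star e)); rewrite ?mul0r // (H _ te).
Qed.

Lemma gf_nonsig phi c : (forall e, tau e -> phi (Star e) = c) ->
  gf (fun e => nonsig e * phi e) = gf phi - fC c * Sgf.
Proof.
by move=> H; rewrite -(gf_sig H) -gfB; apply: eq_gf => e; rewrite nonsigE mulrBl mul1r.
Qed.

Lemma gf_nonsig1 : gf nonsig = Rgf - Sgf.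
Proof. by rewrite -gfB; apply: eq_gf => e; rewrite nonsigE. Qed.

Lemma Sgf_tau : Sgf = fX * gf (fun e => (tau e)%:R).
Proof.
rewrite {1}/Sgf gf_rec /= big1 // addr0 /fC polyC0 rmorph0 add0r gf2_0 addr0.
congr (_ * _); rewrite -[RHS]addr0; congr (_ + _); rewrite -[RHS]gf2_0.
by apply: eq_gf2 => a b; rewrite mulr0.
Qed.

(** A Sigma-star expression has k letters, k - 1 unions and one star, hence size 2k. This is what
    makes D a polynomial. *)
Lemma Sgf_monomial : Sgf = fC (Sgf$(2 * k)) * fX ^+ (2 * k).
Proof.
apply/fpsP => n; rewrite fcoefCM fcoefXX; case: eqP => [->|nk]; first by rewrite mulr1.
rewrite mulr0 fcoef_gf big_seq_cond big1 // => e /andP[/size_enum_re en _].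
case: e en => // e en; case te: (sigma_star k (Star e)) => //.
by have [_ _ _ _ [es k0]] := tauP te; move: en nk; rewrite /= es; lia.
Qed.

Lemma Rgf_eq : Rgf = (k.+1)%:R * fX + fX * Rgf + fX * Rgf ^+ 2 + fX * (Rgf - Sgf) ^+ 2.
Proof.
rewrite {1}/Rgf gf_rec sumr_const card_ord -[1 + _]mulrS fC_nat.
have -> : gf2 (fun a b => nonsig a * nonsig b * 1) = (Rgf - Sgf) ^+ 2.
  by rewrite -gf_nonsig1 expr2 -gf2M; apply: eq_gf2 => a b; rewrite mulr1.
have -> : gf2 (fun _ _ => 1) = Rgf ^+ 2.
  by rewrite expr2 -gf2M; apply: eq_gf2 => a b; rewrite mulr1.
by rewrite -/Rgf; ring.
Qed.

(** Counting the non-nullable expressions makes the equation linear: stars do not contribute, the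
    restriction on unions is void, and the square of M coming from unions cancels the
    inclusion-exclusion term of concatenations. *)
Lemma Mgf_eq : Mgf = k%:R * fX + 2 * fX * Rgf * Mgf.
Proof.
rewrite {1}/Mgf gf_rec /= gf0 add0r sumr_const card_ord fC_nat.
have -> : gf2 (fun a b => nonsig a * nonsig b * (~~ (nullable a || nullable b))%:R)
   = Mgf * Mgf.
  have E : Mgf = gf (fun e => nonsig e * (~~ nullable e)%:R).
    by rewrite (@gf_nonsig _ 0) ?/fC ?polyC0 ?rmorph0 ?mul0r ?subr0.
  rewrite E -gf2M; apply: eq_gf2 => a b.
  by case: (nullable a); case: (nullable b); rewrite /= ?(mulr0, mul0r, mulr1).
have -> : gf2 (fun a b => (~~ (nullable a && nullable b))%:R) =
    Mgf * Rgf + Rgf * Mgf - Mgf * Mgf.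
  rewrite -!gf2M -gf2D; apply/(canRL (addrK _)); rewrite -gf2D.
  apply: eq_gf2 => a b.
  by case: (nullable a); case: (nullable b); rewrite /= ?(mulr0, mul0r, mulr1, addr0, add0r).
by ring.
Qed.

Lemma nullable_natr e : (nullable e)%:R = 1 - (~~ nullable e)%:R :> A.
Proof. by case: nullable; rewrite /= ?subrr ?subr0. Qed.

Lemma gf_nullable : gf (fun e => (nullable e)%:R) = Rgf - Mgf.
Proof. by rewrite -gfB; apply: eq_gf => e; exact: nullable_natr. Qed.

Lemma Fgf_eq : Fgf = k%:R * fX + fX * Fgf + fX * Fgf * Rgf + fX * (Rgf - Mgf) * Fgf
  + 2 * fX * (Fgf - k%:R * Sgf) * (Rgf - Sgf).
Proof.
rewrite {1}/Fgf gf_rec /= add0r sumr_const card_ord fC_nat -/Fgf.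
have -> : gf2 (fun a b => nonsig a * nonsig b * (nfirst a + nfirst b)%:R)
   = (Fgf - k%:R * Sgf) * (Rgf - Sgf) + (Rgf - Sgf) * (Fgf - k%:R * Sgf).
  rewrite -gf_nonsig1 -fC_nat -gf_nonsig; last by move=> e /tauP[fe *]; rewrite /= fe.
  by rewrite -!gf2M -gf2D; apply: eq_gf2 => a b; rewrite natrD; ring.
have -> : gf2 (fun a b => (nfirst a + nullable a * nfirst b)%:R) =
    Fgf * Rgf + (Rgf - Mgf) * Fgf.
  by rewrite -gf_nullable -!gf2M -gf2D; apply: eq_gf2 => a b; rewrite natrD natrM mulr1.
by ring.
Qed.

Lemma Lgf_eq : Lgf = k%:R * fX + fX * Lgf + fX * Lgf * Rgf + fX * (Rgf - Mgf) * Lgf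
  + 2 * fX * (Lgf - k%:R * Sgf) * (Rgf - Sgf).
Proof.
rewrite {1}/Lgf gf_rec /= add0r sumr_const card_ord fC_nat -/Lgf.
have -> : gf2 (fun a b => nonsig a * nonsig b * (nlast a + nlast b)%:R)
   = (Lgf - k%:R * Sgf) * (Rgf - Sgf) + (Rgf - Sgf) * (Lgf - k%:R * Sgf).
  rewrite -gf_nonsig1 -fC_nat -gf_nonsig; last by move=> e /tauP[_ le *]; rewrite /= le.
  by rewrite -!gf2M -gf2D; apply: eq_gf2 => a b; rewrite natrD; ring.
have -> : gf2 (fun a b => (nlast b + nullable b * nlast a)%:R) =
    Rgf * Lgf + Lgf * (Rgf - Mgf).
  rewrite -gf_nullable -!gf2M -gf2D; apply: eq_gf2 => a b.
  by rewrite natrD natrM mul1r [_ * (nlast a)%:R]mulrC.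
by ring.
Qed.

Lemma Xgf_eq' : Xgf = k%:R * fX + fX * Fgf * Lgf + 2 * fX * (Rgf - Mgf) * Xgf
  + 2 * fX * Xgf * (Rgf - Sgf) + 2 * fX * (Fgf - k%:R * Sgf) * (Lgf - k%:R * Sgf).
Proof.
rewrite {1}/Xgf gf_rec /= gf0 add0r addr0 sumr_const card_ord fC_nat.
(* [nextra] vanishes on stars, so excluding the Sigma-star expressions does not change X. *)
have E : gf (fun e => nonsig e * (nextra e)%:R) = Xgf.
  by rewrite (@gf_nonsig _ 0) ?/fC ?polyC0 ?rmorph0 ?mul0r ?subr0.
have -> : gf2 (fun a b => nonsig a * nonsig b *
    (nextra a + nextra b + nlast a * nfirst b + nlast b * nfirst a)%:R)
   = Xgf * (Rgf - Sgf) + (Rgf - Sgf) * Xgf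
     + ((Lgf - k%:R * Sgf) * (Fgf - k%:R * Sgf) + (Fgf - k%:R * Sgf) * (Lgf - k%:R * Sgf)).
  rewrite -gf_nonsig1 -fC_nat -(@gf_nonsig (fun e => (nfirst e)%:R)); last by move=> e /tauP[fe *]; rewrite /= fe.
  rewrite -(@gf_nonsig (fun e => (nlast e)%:R)); last by move=> e /tauP[_ le *]; rewrite /= le.
  by rewrite -E -!gf2M -!gf2D; apply: eq_gf2 => a b; rewrite !natrD !natrM; ring.
have -> : gf2 (fun a b => (nlast b * nfirst a + nullable a * nextra b
      + nullable b * nextra a)%:R) =
    Fgf * Lgf + ((Rgf - Mgf) * Xgf + Xgf * (Rgf - Mgf)).
  rewrite -gf_nullable -!gf2M -!gf2D; apply: eq_gf2 => a b.
  by rewrite !natrD !natrM; ring.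
by ring.
Qed.

Lemma Egf_eq' : Egf = fX * (Egf + Xgf) + fX * (2 * Egf * Rgf + Lgf * Fgf)
  + 2 * fX * (Egf - (k ^ 2)%:R * Sgf) * (Rgf - Sgf).
Proof.
rewrite {1}/Egf gf_rec /= add0r sumr_const card_ord mul0rn /fC polyC0 rmorph0 add0r.
have -> : gf (fun e => (nfollow e + nextra e)%:R) = Egf + Xgf.
  by rewrite -gfD; apply: eq_gf => e; rewrite natrD.
have -> : gf2 (fun a b => nonsig a * nonsig b * (nfollow a + nfollow b)%:R)
   = (Egf - (k ^ 2)%:R * Sgf) * (Rgf - Sgf) + (Rgf - Sgf) * (Egf - (k ^ 2)%:R * Sgf).
  rewrite -gf_nonsig1 -[(k ^ 2)%:R]fC_nat -gf_nonsig; last by move=> e /tauP[_ _ xe we _]; rewrite /= xe we.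
  by rewrite -!gf2M -gf2D; apply: eq_gf2 => a b; rewrite natrD; ring.
have -> : gf2 (fun a b => (nfollow a + nfollow b + nlast a * nfirst b)%:R) =
    Egf * Rgf + Rgf * Egf + Lgf * Fgf.
  by rewrite -!gf2M -!gf2D; apply: eq_gf2 => a b; rewrite !natrD natrM; ring.
by ring.
Qed.

End GenFun.

Section GenFunDomain.
Variables (A : numDomainType) (k : nat).
Local Notation F := (Fgf A k).
Local Notation L := (Lgf A k).
Local Notation R_ := (Rgf A k).
Local Notation M := (Mgf A k).
Local Notation S_ := (Sgf A k).
Local Notation X_ := (Xgf A k).
Local Notation E := (Egf A k).

(** Both solve the same linear equation, whose factor [1 - u] has constant term 1. This replaces a
    mirror-image bijection on expressions. *)
Lemma Lgf_Fgf : L = F.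
Proof.
pose u := fX * (1 + R_ + (R_ - M) + 2 * (R_ - S_)).
apply: (@fmulIr _ _ _ (1 - u)); last by rewrite fcoefB fcoef1 fcoefXM subr0 oner_neq0.
have HF : F * (1 - u) = k%:R * fX - 2 * fX * k%:R * S_ * (R_ - S_).
  by rewrite mulrBr mulr1 {1}Fgf_eq /u; ring.
have HL : L * (1 - u) = k%:R * fX - 2 * fX * k%:R * S_ * (R_ - S_).
  by rewrite mulrBr mulr1 {1}Lgf_eq /u; ring.
by rewrite HF HL.
Qed.

Lemma Xgf_eq : X_ = k%:R * fX + fX * F ^+ 2 + 2 * fX * (R_ - M) * X_
  + 2 * fX * X_ * (R_ - S_) + 2 * fX * (F - k%:R * S_) ^+ 2.
Proof. by rewrite {1}Xgf_eq' Lgf_Fgf; ring. Qed.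

Lemma Egf_eq : E = fX * (E + X_) + fX * (2 * E * R_ + F ^+ 2)
  + 2 * fX * (E - k%:R ^+ 2 * S_) * (R_ - S_).
Proof. by rewrite {1}Egf_eq' Lgf_Fgf natrX; ring. Qed.

Lemma le_gf (phi psi : regex -> A) n : (forall e, phi e <= psi e) ->
  (gf k phi)$n <= (gf k psi)$n.
Proof. by move=> H; apply: ler_sum => e _. Qed.

Lemma gf_ge0 (phi : regex -> A) n : (forall e, 0 <= phi e) -> 0 <= (gf k phi)$n.
Proof. by move=> H; apply: sumr_ge0. Qed.

Lemma Fgf_ge_Sgf n : k%:R * S_$n <= (fX * F)$n.
Proof.
rewrite Sgf_tau !fcoefXM; case: n => [|n]; first by rewrite mulr0.
rewrite -fcoefCM -gfZ; apply: le_gf => e; case te: (tau k e).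
  by have [-> _ _ _ _] := tauP te; rewrite mulr1.
by rewrite mulr0.
Qed.

Lemma Xgf_ge_Sgf n : k%:R ^+ 2 * S_$n <= (fX * X_)$n.
Proof.
rewrite Sgf_tau !fcoefXM; case: n => [|n]; first by rewrite mulr0.
rewrite -fcoefCM -gfZ; apply: le_gf => e; case te: (tau k e).
  by have [_ _ -> _ _] := tauP te; rewrite mulr1 natrX.
by rewrite mulr0.
Qed.

Lemma Rgf_count n : R_$n = (r_count k n)%:R.
Proof. by rewrite fcoef_gf /r_count -sum1_count natr_sum. Qed.

Lemma t_count_gf n : (F + E)$n = (t_count k n)%:R.
Proof.
rewrite fcoefD !fcoef_gf -!natr_sum -natrD -big_split /t_count; congr (_ %:R).
by apply: eq_bigr => e _; rewrite glushkov_transitionsE.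
Qed.

Lemma Sgf_le_Rgf n : S_$n <= R_$n.
Proof. by apply: le_gf => e; case: sigma_star => /=; rewrite ?ler01. Qed.
Lemma Mgf_le_Rgf n : M$n <= R_$n.
Proof. by apply: le_gf => e; case: nullable => /=; rewrite ?ler01. Qed.
Lemma Sgf_ge0 n : 0 <= S_$n. Proof. exact: gf_ge0. Qed.
Lemma Mgf_ge0 n : 0 <= M$n. Proof. exact: gf_ge0. Qed.
Lemma Fgf_ge0 n : 0 <= F$n. Proof. exact: gf_ge0. Qed.
Lemma Xgf_ge0 n : 0 <= X_$n. Proof. exact: gf_ge0. Qed.
End GenFunDomain.

(** * Summable power series *)

Section NonNeg.
Variable R : realDomainType.
Implicit Types a b u : fps R.
Definition fnonneg a := forall n, 0 <= a$n.
Definition fabs a : fps R := fun n => `|a$n|.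
Definition psum a N := \sum_(i < N) a$i.

Lemma fcoef_abs a n : (fabs a)$n = `|a$n|. Proof. by []. Qed.
Lemma fabs_ge0 a : fnonneg (fabs a). Proof. by move=> n; rewrite fcoef_abs. Qed.
Lemma fabs_id a : fnonneg a -> fabs a = a.
Proof. by move=> a0; apply/fpsP => n; rewrite fcoef_abs ger0_norm. Qed.
Lemma fnonnegD a b : fnonneg a -> fnonneg b -> fnonneg (a + b).
Proof. by move=> a0 b0 n; rewrite fcoefD addr_ge0. Qed.
Lemma fnonnegM a b : fnonneg a -> fnonneg b -> fnonneg (a * b).
Proof. by move=> a0 b0 n; rewrite fcoefM; apply: sumr_ge0 => i _; rewrite mulr_ge0. Qed.
Lemma fnonneg1 : fnonneg (1 : fps R).
Proof. by move=> n; rewrite fcoef1 ler0n. Qed.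
Lemma fnonnegX : fnonneg (fX : fps R).
Proof. by move=> n; rewrite fcoefX ler0n. Qed.
Lemma fnonneg_nat m : fnonneg (m%:R : fps R).
Proof. by move=> n; rewrite -fC_nat fcoefC; case: eqP. Qed.
Lemma fnonnegC c : 0 <= c -> fnonneg (fC c : fps R).
Proof. by move=> c0 n; rewrite fcoefC; case: eqP. Qed.
Lemma fnonneg_exp a m : fnonneg a -> fnonneg (a ^+ m).
Proof.
by move=> a0; elim: m => [|m IH]; [exact: fnonneg1|rewrite exprS; exact: fnonnegM].
Qed.
Lemma fnonneg_inv1 u : fnonneg u -> fnonneg (finv1 u).
Proof.
move=> u0 n; have -> : (finv1 u)$n = (\sum_(j < n.+1) u ^+ j)$n by [].
by rewrite fcoef_sum; apply: sumr_ge0 => j _; exact: fnonneg_exp.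
Qed.

Lemma psumD a b N : psum (a + b) N = psum a N + psum b N.
Proof. by rewrite /psum -big_split. Qed.
Lemma psumB a b N : psum (a - b) N = psum a N - psum b N.
Proof. by rewrite /psum -sumrB. Qed.
Lemma le_psum a b N : (forall n, a$n <= b$n) -> psum a N <= psum b N.
Proof. by move=> ab; apply: ler_sum => i _. Qed.
Lemma psum_ge0 a N : fnonneg a -> 0 <= psum a N.
Proof. by move=> a0; apply: sumr_ge0. Qed.
Lemma psum_homo a m n : fnonneg a -> (m <= n)%N -> psum a m <= psum a n.
Proof.
move=> a0 mn; rewrite -(subnKC mn) /psum big_split_ord /= lerDl.
by apply: sumr_ge0.
Qed.
Lemma ftrunc_horner1 a N : (ftrunc N a).[1] = psum a N.
Proof.
rewrite (horner_coef_wide _ (size_poly _ _)); apply: eq_bigr => i _.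
by rewrite expr1n mulr1 coef_ftrunc.
Qed.
Lemma psumM_trunc a b N :
  psum a N * psum b N = \sum_(i < N + N) (ftrunc N a * ftrunc N b)`_i.
Proof.
rewrite -!ftrunc_horner1 -hornerM (@horner_coef_wide _ (N + N)).
  by apply: eq_bigr => i _; rewrite expr1n mulr1.
apply: (leq_trans (size_polyMleq _ _)); apply: (leq_trans (leq_pred _)).
by apply: leq_add; exact: size_poly.
Qed.
Lemma psumM_le a b N : fnonneg a -> fnonneg b -> psum (a * b) N <= psum a N * psum b N.
Proof.
move=> a0 b0; rewrite psumM_trunc big_split_ord /=.
rewrite (eq_bigr (fun i : 'I_N => (a * b)$i)) ?lerDl => [|i _].
  apply: sumr_ge0 => i _; rewrite coefM; apply: sumr_ge0 => j _.
  by rewrite !coef_poly; apply: mulr_ge0; case: ifP.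
by rewrite (@fcoefM_trunc _ N).
Qed.
Lemma psumM_ge a b N : fnonneg a -> fnonneg b ->
  psum a N * psum b N <= psum (a * b) (N + N).
Proof.
move=> a0 b0; rewrite psumM_trunc; apply: ler_sum => i _.
rewrite coefM fcoefM; apply: ler_sum => j _; rewrite !coef_poly.
by case: ifP => _; case: ifP => _; rewrite ?mulr0 ?mul0r ?mulr_ge0.
Qed.
Lemma fabsM_le a b n : (fabs (a * b))$n <= (fabs a * fabs b)$n.
Proof.
rewrite fcoef_abs !fcoefM (le_trans (ler_norm_sum _ _ _)) //.
by apply: ler_sum => i _; rewrite normrM.
Qed.
End NonNeg.

Section Sums.
Variable R : realType.
Implicit Types a b g u v w : fps R.

Definition l1 a := exists C, forall N, psum (fabs a) N <= C.
Definition c0 a := (fun n => a$n) @ \oo --> (0 : R).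
Definition fsum a : R := limn (psum a).

Lemma psum_series a : psum a = series (fun n => a$n).
Proof. by apply/funext => N; rewrite /psum /series /= big_mkord. Qed.

Lemma l1_is_cvg_abs a : l1 a -> cvgn (psum (fabs a)).
Proof.
case=> C aC; apply: nondecreasing_is_cvgn => [m n|].
  by apply: psum_homo; exact: fabs_ge0.
by exists C => _ [n _ <-].
Qed.

Lemma l1_cvg a : l1 a -> psum a @ \oo --> fsum a.
Proof.
move=> /l1_is_cvg_abs; rewrite /fsum !psum_series => H.
exact: (@normed_cvg _ _ (fun n => a$n) H).
Qed.

Lemma fsum_unique a l : psum a @ \oo --> l -> fsum a = l.
Proof. by move/cvg_lim; apply; exact: norm_hausdorff. Qed.

Lemma l1_dom a b : (forall n, `|a$n| <= b$n) -> l1 b -> l1 a.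
Proof.
move=> ab [C bC]; exists C => N; apply: le_trans (bC N); apply: le_psum => n.
by rewrite !fcoef_abs (le_trans (ab n)) // ler_norm.
Qed.
Lemma l1_nonneg a C : fnonneg a -> (forall N, psum a N <= C) -> l1 a.
Proof. by move=> a0 aC; exists C => N; rewrite fabs_id. Qed.
Lemma l1_abs a : l1 a -> l1 (fabs a).
Proof. by case=> C aC; apply: (@l1_nonneg _ C) => //; exact: fabs_ge0. Qed.
Lemma l1D a b : l1 a -> l1 b -> l1 (a + b).
Proof.
move=> [C aC] [D bD]; exists (C + D) => N.
apply: le_trans (lerD (aC N) (bD N)); rewrite -psumD; apply: le_psum => n.
by rewrite fcoefD !fcoef_abs fcoefD ler_normD.
Qed.
Lemma l1N a : l1 a -> l1 (- a).
Proof.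
by case=> C aC; exists C => N; apply: le_trans (aC N); apply: le_psum => n;
  rewrite !fcoef_abs fcoefN normrN.
Qed.
Lemma l1B a b : l1 a -> l1 b -> l1 (a - b).
Proof. by move=> la lb; apply: l1D => //; exact: l1N. Qed.
Lemma l1M a b : l1 a -> l1 b -> l1 (a * b).
Proof.
move=> [C aC] [D bD]; apply: (@l1_dom _ (fabs a * fabs b)).
  by move=> n; rewrite -fcoef_abs fabsM_le.
apply: (@l1_nonneg _ (C * D)); first by apply: fnonnegM; exact: fabs_ge0.
move=> N; apply: le_trans (psumM_le _ (fabs_ge0 _) (fabs_ge0 _)) _.
by apply: ler_pM => //; apply: psum_ge0; exact: fabs_ge0.
Qed.
Lemma psum_pfps (p : {poly R}) N : (size p <= N)%N -> psum (pfps p) N = p.[1].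
Proof.
move=> pN; rewrite (horner_coef_wide _ pN); apply: eq_bigr => i _.
by rewrite expr1n mulr1.
Qed.
Lemma l1_pfps p : l1 (pfps p).
Proof.
pose q := \poly_(i < size p) `|p`_i| : {poly R}.
have E : fabs (pfps p) = pfps q.
  apply/fpsP => n; rewrite fcoef_abs !fcoef_pfps coef_poly; case: ltnP => // pn.
  by rewrite nth_default ?normr0.
apply: (@l1_dom _ (pfps q)) => [n|]; first by rewrite -fcoef_abs E.
have q0 : fnonneg (pfps q) by rewrite -E; exact: fabs_ge0.
apply: (@l1_nonneg _ q.[1]) => // N.
rewrite -(@psum_pfps q (N + size q)) ?leq_addl //.
by apply: psum_homo => //; exact: leq_addr.
Qed.
Lemma l1_1 : l1 1. Proof. by rewrite -(rmorph1 (@pfps R)); exact: l1_pfps. Qed.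
Lemma l1_X : l1 fX. Proof. exact: l1_pfps. Qed.
Lemma l1_C c : l1 (fC c). Proof. exact: l1_pfps. Qed.
Lemma l1_nat m : l1 m%:R. Proof. by rewrite -fC_nat; exact: l1_C. Qed.
Lemma l1_exp a m : l1 a -> l1 (a ^+ m).
Proof.
by move=> la; elim: m => [|m IH]; [exact: l1_1|rewrite exprS; exact: l1M].
Qed.

Lemma fsumD a b : l1 a -> l1 b -> fsum (a + b) = fsum a + fsum b.
Proof.
move=> la lb; apply: fsum_unique.
rewrite (_ : psum (a + b) = psum a \+ psum b); last by apply/funext => N; rewrite psumD.
by apply: cvgD; exact: l1_cvg.
Qed.
Lemma fsumB a b : l1 a -> l1 b -> fsum (a - b) = fsum a - fsum b.
Proof.
move=> la lb; apply: fsum_unique.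
rewrite (_ : psum (a - b) = psum a \- psum b); last by apply/funext => N; rewrite psumB.
by apply: cvgB; exact: l1_cvg.
Qed.
Lemma fsum_pfps p : fsum (pfps p) = p.[1].
Proof.
apply: fsum_unique; apply: cvg_near_cst; exists (size p) => // n /= pn.
exact: psum_pfps.
Qed.
Lemma fsum1 : fsum 1 = 1.
Proof. by rewrite -(rmorph1 (@pfps R)) fsum_pfps hornerC. Qed.
Lemma fsumX : fsum fX = 1. Proof. by rewrite fsum_pfps hornerX. Qed.
Lemma fsumC c : fsum (fC c) = c. Proof. by rewrite fsum_pfps hornerC. Qed.
Lemma fsum_nat m : fsum m%:R = m%:R. Proof. by rewrite -fC_nat fsumC. Qed.

Lemma psum_le_fsum a N : fnonneg a -> l1 a -> psum a N <= fsum a.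
Proof.
move=> a0 la; apply: limr_ge; first exact: l1_cvg.
by exists N => // n /= Nn; exact: psum_homo.
Qed.
Lemma fsum_le_bound a C : l1 a -> (forall N, psum a N <= C) -> fsum a <= C.
Proof.
move=> la aC; apply: limr_le; last by exists 0%N.
exact: l1_cvg.
Qed.
Lemma fsum_ge0 a : fnonneg a -> l1 a -> 0 <= fsum a.
Proof. by move=> a0 la; apply: le_trans (psum_le_fsum 0 a0 la); rewrite /psum big_ord0. Qed.
Lemma le_fsum a b : l1 a -> l1 b -> (forall n, a$n <= b$n) -> fsum a <= fsum b.
Proof.
move=> la lb ab; rewrite -subr_ge0 -fsumB //; apply: fsum_ge0; last exact: l1B.
by move=> n; rewrite fcoefB subr_ge0.
Qed.
(** The square of side N contains the index triangle of size N and lies in that of size 2N, which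
    squeezes the partial sums of the product. *)
Lemma fsumM_nonneg a b : fnonneg a -> fnonneg b -> l1 a -> l1 b ->
  fsum (a * b) = fsum a * fsum b.
Proof.
move=> a0 b0 la lb; have lab := l1M la lb; have ab0 := fnonnegM a0 b0.
apply/eqP; rewrite eq_le; apply/andP; split.
  apply: fsum_le_bound => // N; apply: le_trans (psumM_le _ a0 b0) _.
  by apply: ler_pM; rewrite ?psum_ge0 // psum_le_fsum.
have H : (fun N => psum a N * psum b N) @ \oo --> fsum a * fsum b.
  by apply: cvgM; exact: l1_cvg.
rewrite -(cvg_lim (@norm_hausdorff _ _) H); apply: limr_le.
  by apply/cvg_ex; exists (fsum a * fsum b).
exists 0%N => // N _ /=; apply: le_trans (psumM_ge _ a0 b0) _.
exact: psum_le_fsum.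
Qed.

Lemma fsumM a b : l1 a -> l1 b -> fsum (a * b) = fsum a * fsum b.
Proof.
have nn c : fnonneg (fabs c + c).
  by move=> n; rewrite fcoefD fcoef_abs -lerBlDr sub0r -normrN ler_norm.
move=> la lb; have [la' lb'] := (l1_abs la, l1_abs lb).
(* Each factor is the difference of the nonnegative summable series |a| + a and |a|. *)
have {1}-> : a * b = (fabs a + a) * (fabs b + b) - (fabs a + a) * fabs b
    - fabs a * (fabs b + b) + fabs a * fabs b by ring.
have [na nb] := (@fabs_ge0 _ a, @fabs_ge0 _ b).
have [la'' lb''] := (l1D la' la, l1D lb' lb).
have [l11 l12] := (l1M la'' lb'', l1M la'' lb').
have [l21 l22] := (l1M la' lb'', l1M la' lb').
rewrite (fsumD (l1B (l1B l11 l12) l21) l22) (fsumB (l1B l11 l12) l21) (fsumB l11 l12).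
by rewrite !fsumM_nonneg // !fsumD //; ring.
Qed.
Lemma fsum_exp a m : l1 a -> fsum (a ^+ m) = fsum a ^+ m.
Proof.
move=> la; elim: m => [|m IH]; first exact: fsum1.
by rewrite !exprS fsumM ?IH //; exact: l1_exp.
Qed.

Lemma l1_c0 a : l1 a -> c0 a.
Proof.
move=> /l1_cvg H; apply: cvg_series_cvg_0; rewrite -psum_series.
by apply/cvg_ex; exists (fsum a).
Qed.

(** The absorption is made on finite partial sums, psum f N <= C + fsum u * psum f N, so f need not
    be known to be summable beforehand. *)
Lemma l1_renewal f g u : fnonneg f -> fnonneg u -> l1 u -> l1 g -> fsum u < 1 ->
  (forall n, f$n <= g$n + (u * f)$n) -> l1 f.
Proof.
move=> f0 u0 lu [C gC] u1 H; apply: (@l1_nonneg _ (C / (1 - fsum u))) => // N.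
rewrite ler_pdivlMr ?subr_gt0 // mulrBr mulr1 lerBlDr.
have : psum f N <= psum (g + u * f) N by apply: le_psum => n; rewrite fcoefD.
rewrite psumD => /le_trans; apply; apply: lerD.
  by apply: le_trans (gC N); apply: le_psum => n; rewrite fcoef_abs ler_norm.
apply: le_trans (psumM_le _ u0 f0) _; rewrite mulrC.
by apply: ler_wpM2l; [exact: psum_ge0|exact: psum_le_fsum].
Qed.

Lemma c0P a : c0 a <-> forall e : R, 0 < e -> exists N, forall n, (N <= n)%N -> `|a$n| <= e.
Proof.
split=> [/cvgrPdist_le H e /H [N _ HN]|H].
  by exists N => n /HN; rewrite sub0r normrN.
apply/cvgrPdist_le => e /H [N HN]; exists N => // n /= /HN.
by rewrite sub0r normrN.
Qed.

Lemma c0D a b : c0 a -> c0 b -> c0 (a + b).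
Proof. by move=> ca cb; rewrite /c0 -[0]addr0; apply: cvgD. Qed.
Lemma c0N a : c0 a -> c0 (- a).
Proof. by move=> ca; rewrite /c0 -oppr0; apply: cvgN. Qed.
Lemma c0M a b : c0 a -> l1 b -> c0 (a * b).
Proof.
move=> ca lb; have [B bB] := lb; apply/c0P => e e0.
have B0 : 0 <= B by apply: le_trans (bB 0%N); rewrite /psum big_ord0.
(* [B + 1] because [B] may be 0. Beyond N the coefficients of a are small; below N they form a
   polynomial, whose product with b is summable. *)
have e20 : 0 < e / 2 / (B + 1) by rewrite !divr_gt0 ?ltr0n // ltr_wpDl.
have [N aN] := (c0P a).1 ca _ e20.
pose p := ftrunc N a; pose a' := a - pfps p.
have a'N n : `|a'$n| <= e / 2 / (B + 1).
  rewrite /a' fcoefB fcoef_pfps coef_poly; case: ltnP => nN; first by rewrite subrr normr0 ltW.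
  by rewrite subr0; exact: aN.
have pb : c0 (pfps p * b) by apply/l1_c0/l1M => //; exact: l1_pfps.
have [N' pN'] := (c0P _).1 pb (e / 2) (divr_gt0 e0 (ltr0Sn _ 1)).
exists N' => n N'n.
have -> : a * b = pfps p * b + a' * b by rewrite /a'; ring.
rewrite fcoefD (le_trans (ler_normD _ _)) //.
have H1 := pN' n N'n.
suff : `|(a' * b)$n| <= e / 2 by lra.
apply: le_trans (fabsM_le _ _ _) _; rewrite mulrC fcoefM.
apply: (@le_trans _ _ (\sum_(i < n.+1) (fabs b)$i * (e / 2 / (B + 1)))).
  by apply: ler_sum => i _; apply: ler_wpM2l; [exact: fabs_ge0|exact: a'N].
rewrite -mulr_suml mulrA ler_pdivrMr; last lra.
rewrite mulrC; apply: ler_wpM2l; first lra.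
by apply: le_trans (bB n.+1) _; lra.
Qed.

(* Since theta is a derivation and c0 a module over l1, this is an algebra, closed
   under those inversions that stay in l1. *)
Definition smooth a := l1 a /\ c0 (ftheta a).
Lemma smoothD a b : smooth a -> smooth b -> smooth (a + b).
Proof.
by move=> [la ca] [lb cb]; split; [exact: l1D|rewrite raddfD; exact: c0D].
Qed.
Lemma smoothN a : smooth a -> smooth (- a).
Proof. by move=> [la ca]; split; [exact: l1N|rewrite raddfN; exact: c0N]. Qed.
Lemma smoothB a b : smooth a -> smooth b -> smooth (a - b).
Proof. by move=> sa sb; apply: smoothD => //; exact: smoothN. Qed.
Lemma smoothM a b : smooth a -> smooth b -> smooth (a * b).
Proof.
move=> [la ca] [lb cb]; split; [exact: l1M|rewrite fthetaM; apply: c0D].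
  exact: c0M.
by rewrite mulrC; exact: c0M.
Qed.
Lemma smooth_pfps p : smooth (pfps p).
Proof.
split; first exact: l1_pfps.
apply: cvg_near_cst; exists (size p) => // n /= pn.
by rewrite fcoef_theta fcoef_pfps nth_default ?mulr0.
Qed.
Lemma smoothX : smooth fX. Proof. exact: smooth_pfps. Qed.
Lemma smoothC c : smooth (fC c). Proof. exact: smooth_pfps. Qed.
Lemma smooth1 : smooth 1.
Proof. by rewrite -(rmorph1 (@pfps R)); exact: smooth_pfps. Qed.
Lemma smooth_nat m : smooth m%:R.
Proof. by rewrite -fC_nat; exact: smoothC. Qed.
Lemma smooth_exp a m : smooth a -> smooth (a ^+ m).
Proof.
by move=> la; elim: m => [|m IH]; [exact: smooth1|rewrite exprS; exact: smoothM].
Qed.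

Lemma smooth_inv1 u : fnonneg u -> u$0 = 0 -> smooth u -> fsum u < 1 ->
  smooth (finv1 u).
Proof.
move=> u0 u00 [lu cu] u1; have vE := finv1E u00; set v := finv1 u in vE *.
have lv : l1 v.
  apply: (@l1_renewal _ 1 u) => //; [exact: fnonneg_inv1|exact: l1_1|].
  by move=> n; rewrite -fcoefD -vE.
split=> //; have -> : ftheta v = ftheta u * v ^+ 2; last by apply: c0M => //; exact: l1_exp.
have H : ftheta v * (1 - u) = ftheta u * v.
  have H0 : ftheta v = ftheta u * v + u * ftheta v.
    by rewrite {1}vE raddfD /= fthetaM ftheta1 add0r.
  by rewrite mulrBr mulr1 {1}H0; ring.
have H1 : (1 - u) * v = 1 by rewrite mulrBl mul1r {1}vE; ring.
by rewrite -[LHS]mulr1 -H1 mulrA H; ring.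
Qed.
End Sums.

(** * Transfer from (1 - z)^(-1/2) *)

Section InvSqrt.
Variable F : numFieldType.
(* The expansion of (1 - z)^(-1/2). *)
Definition isq : fps F := fun n => \prod_(i < n) ((2 * i%:R + 1) / (2 * i%:R + 2)).
Lemma isq0 : isq$0 = 1. Proof. exact: big_ord0. Qed.
Lemma isqS n : isq$n.+1 = isq$n * ((2 * n%:R + 1) / (2 * n%:R + 2)).
Proof. by rewrite /fcoef /isq big_ord_recr. Qed.

Lemma isq_ode : 2 * (1 - fX) * ftheta isq = fX * isq.
Proof.
have -> : 2 * (1 - fX) * ftheta isq = fC 2 * (ftheta isq - fX * ftheta isq).
  by rewrite fC_nat; ring.
apply/fpsP => n; rewrite fcoefCM fcoefB !fcoefXM !fcoef_theta.
case: n => [|n]; first by rewrite mul0r subr0 mulr0.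
rewrite fcoef_theta isqS.
have n0 : 2 * n%:R + 2 != 0 :> F by rewrite -natrM -natrD pnatr_eq0 addn2.
by rewrite -natr1; field.
Qed.

(** By the differential equation theta kills the left side, so only its constant term is left; no
    binomial convolution is computed. *)
Lemma isq_sqr : (1 - fX) * isq ^+ 2 = 1.
Proof.
have H : ftheta ((1 - fX) * isq ^+ 2) = 0.
  rewrite expr2 !fthetaM raddfB /= ftheta1 fthetaX.
  have -> : (0 - fX) * (isq * isq) + (1 - fX) * (ftheta isq * isq + isq * ftheta isq)
     = isq * (2 * (1 - fX) * ftheta isq - fX * isq) by ring.
  by rewrite isq_ode subrr mulr0.
apply/fpsP => -[|n]; rewrite fcoef1.
  by rewrite expr2 !fcoefM0 isq0 fcoefB fcoef1 fcoefX subr0 !mulr1.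
have := congr1 (fun a : fps F => a$n.+1) H; rewrite fcoef_theta fcoef0 => /eqP.
by rewrite mulf_eq0 pnatr_eq0 /= => /eqP.
Qed.

Lemma isq_gt0 n : 0 < isq$n.
Proof. by apply: prodr_gt0 => i _; rewrite divr_gt0 // ltr_wpDl ?mulr_ge0. Qed.
Lemma isqS_le n : isq$n.+1 <= isq$n.
Proof.
have n0 : 0 <= n%:R :> F by [].
rewrite isqS ger_pMr ?isq_gt0 // ler_pdivrMr ?mul1r ?ltr_wpDl ?mulr_ge0 //.
by rewrite lerD2l ler1n.
Qed.
Lemma isq_le1 n : isq$n <= 1.
Proof. by elim: n => [|n IH]; rewrite ?isq0 // (le_trans (isqS_le n)). Qed.

(** With b the series [isq], (m + 1) b(m+1) = (m + 1/2) b(m), so m b(m) is nondecreasing. *)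
Lemma isq_ratio n j : (n%:R) * isq$n <= (n + j)%:R * isq$(n + j)%N.
Proof.
elim: j => [|j IH]; first by rewrite addn0.
apply: le_trans IH _; rewrite addnS isqS mulrCA mulrC.
apply: ler_wpM2l; first exact/ltW/isq_gt0.
set m := (n + j)%N; rewrite mulrA ler_pdivlMr ?ltr_wpDl ?mulr_ge0 //.
rewrite -natr1 -subr_ge0; set d := (X in 0 <= X).
have -> : d = m%:R + 1 by rewrite /d; ring.
by rewrite natr1.
Qed.
End InvSqrt.

Section Transfer.
Variable R : realType.
Implicit Types a h c : fps R.
Local Notation b := (isq R).

(** Wallis bounds by monotonicity: (2n + 1) b(n)^2 decreases from 1 at n = 0, and in the next lemma
    4n b(n)^2 increases from 1 at n = 1. So b(n) is of order n^(-1/2). *)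
Lemma isq_upper n : (2 * n%:R + 1) * b$n ^+ 2 <= 1.
Proof.
elim: n => [|n IH]; first by rewrite isq0 expr1n mulr1 mulr0 add0r.
rewrite isqS exprMn mulrCA.
apply: le_trans IH; rewrite mulrC; apply: ler_wpM2r; first exact: sqr_ge0.
have n0 : 0 <= n%:R :> R by [].
rewrite expr_div_n mulrA ler_pdivrMr ?exprn_gt0 ?ltr_wpDl ?mulr_ge0 // -[n.+1%:R]natr1.
move: (n%:R) n0 => x x0; rewrite -subr_ge0; set d := (X in 0 <= X).
by have -> : d = 2 * x + 1; [rewrite /d; ring|rewrite ltW // ltr_wpDl ?mulr_ge0].
Qed.
Lemma isq_lower n : (0 < n)%N -> 1 <= 4 * n%:R * b$n ^+ 2.
Proof.
elim: n => [//|[_ _|n IH _]].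
  by rewrite isqS isq0 mul1r mulr0 !add0r expr_div_n expr1n -natrX -natrM; lra.
apply: le_trans (IH isT) _; rewrite [b$(n.+2)]isqS exprMn [in leRHS]mulrCA [leLHS]mulrC.
apply: ler_wpM2l; first exact: sqr_ge0.
have n0 : 0 <= n%:R :> R by [].
rewrite expr_div_n mulrA ler_pdivlMr ?exprn_gt0 ?ltr_wpDl ?mulr_ge0 // -[n.+2%:R]natr1 -[n.+1%:R]natr1.
move: (n%:R) n0 => x x0; rewrite -subr_ge0; set d := (X in 0 <= X).
by have -> : d = 4 * (x + 2); [rewrite /d; ring|rewrite mulr_ge0 // addr_ge0].
Qed.
(** These are the coefficients of (1 - z)^(-3/2). *)
Lemma isq_sum n : psum b n.+1 = (2 * n%:R + 1) * b$n.
Proof.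
elim: n => [|n IH]; first by rewrite /psum big_ord1 mulr0 add0r mul1r.
rewrite /psum big_ord_recr /= -/(psum b n.+1) IH isqS.
have n0 : 0 <= n%:R :> R by [].
rewrite -[n.+1%:R]natr1; field; lra.
Qed.

Lemma isq_c0 : c0 b.
Proof.
apply/c0P => e e0; have := @archi_boundP R (e ^- 2); set N := Num.bound _ => HN.
exists N => n Nn; rewrite ger0_norm ?(ltW (isq_gt0 _ _)) //.
rewrite -(@ler_pXn2r _ 2) ?nnegrE ?(ltW (isq_gt0 _ _)) ?(ltW e0) //.
have nn : e ^- 2 <= (2 * n%:R + 1).
  apply: ltW; apply: lt_le_trans (HN _) _; first by rewrite invr_ge0 exprn_ge0 // ltW.
  by rewrite -natrM natr1 ler_nat; lia.
have e2 : 0 < e ^+ 2 by rewrite exprn_gt0.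
rewrite -(ler_pM2l (_ : 0 < e ^- 2)) ?invr_gt0 // mulVf ?gt_eqF //.
apply: le_trans (isq_upper n); apply: ler_wpM2r => //; exact: sqr_ge0.
Qed.

Lemma inv_isq n : (0 < n)%N -> (n%:R * b$n)^-1 <= 4 * b$n.
Proof.
move=> n0; have bn := isq_gt0 R n.
rewrite -[leLHS]mul1r ler_pdivrMr; last by rewrite mulr_gt0 // ltr0n.
by apply: le_trans (isq_lower n0) _; rewrite expr2; lra.
Qed.

(** A coefficient o(1/n) is negligible against b(n), of order n^(-1/2): smooth terms vanish in the
    comparison. *)
Lemma c0_isq_ratio a : c0 (ftheta a) -> (fun n => a$n / b$n) @ \oo --> (0 : R).
Proof.
move=> ca; apply/(c0P (fun n => a$n / b$n)) => e e0.
have [N HN] := (c0P _).1 ca (e / 4) (divr_gt0 e0 (ltr0Sn _ 3)).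
exists N.+1 => n Nn; have n0 : (0 < n)%N by lia.
have bn := isq_gt0 R n; have := HN n (ltnW Nn); rewrite fcoef_theta normrM normr_nat => H.
rewrite {1}/fcoef normrM normfV (gtr0_norm bn).
have -> : `|a$n| / b$n = (n%:R * `|a$n|) * (n%:R * b$n)^-1.
  by field; rewrite gt_eqF //= pnatr_eq0 -lt0n.
apply: (@le_trans _ _ (e / 4 * (4 * b$n))).
  by apply: ler_pM; [rewrite mulr_ge0|rewrite invr_ge0 mulr_ge0 // ltW|exact: H|exact: inv_isq].
have b1 : b$n <= 1 by exact: isq_le1.
have -> : e / 4 * (4 * b$n) = e * b$n by field.
by rewrite ger_pMr.
Qed.

(* By [isq_ratio], b(n-i) - b(n) <= (i/n) b(n-i), so the error is at most
   (theta|h| * b)(n) / (n b(n)), where theta|h| tends to 0. *)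
Lemma smooth_transfer h : smooth h -> (fun n => (h * b)$n / b$n) @ \oo --> fsum h.
Proof.
case=> lh ch.
suff H : (fun n => (h * b)$n / b$n - psum h n.+1) @ \oo --> (0 : R).
  have H2 : (fun n => psum h n.+1) @ \oo --> fsum h.
    by have := l1_cvg lh; rewrite -(cvg_shiftS (psum h)).
  rewrite (_ : (fun n => (h * b)$n / b$n) =
    (fun n => (h * b)$n / b$n - psum h n.+1) \+ (fun n => psum h n.+1)); last first.
    by apply/funext => n /=; rewrite subrK.
  by rewrite -[fsum h]add0r; exact: cvgD.
pose c : fps R := fabs (ftheta h).
have cE n : c$n = n%:R * `|h$n| by rewrite fcoef_abs fcoef_theta normrM normr_nat.
have key n : (0 < n)%N ->
    `|(h * b)$n / b$n - psum h n.+1| <= (c * b)$n / (n%:R * b$n).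
  move=> n0; have bn := isq_gt0 R n; have n0' : 0 < n%:R :> R by rewrite ltr0n.
  rewrite ler_pdivlMr ?mulr_gt0 //.
  have -> : `|(h * b)$n / b$n - psum h n.+1| * (n%:R * b$n) =
      n%:R * `|(h * b)$n - psum h n.+1 * b$n|.
    rewrite mulrCA -[X in _ * (_ * X)](gtr0_norm bn) -normrM mulrBl divfK //.
    by rewrite gt_eqF.
  rewrite fcoefM /psum mulr_suml -sumrB.
  apply: (@le_trans _ _ (n%:R * \sum_(i < n.+1) `|h$i| * (b$(n - i)%N - b$n))).
    apply: ler_wpM2l; first exact: ltW.
    apply: le_trans (ler_norm_sum _ _ _) _; apply: ler_sum => i _.
    rewrite -mulrBr normrM ler_wpM2l // ger0_norm // subr_ge0.
    rewrite -{1}(@subnK i n) ?leq_ord //; move: (n - i)%N => m.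
    by elim: (nat_of_ord i) => [|j IH]; rewrite ?addn0 // addnS (le_trans (isqS_le _ _)).
  rewrite mulr_sumr fcoefM; apply: ler_sum => i _.
  rewrite cE [leLHS]mulrCA [leRHS]mulrAC [leRHS]mulrC; apply: ler_wpM2l => //.
  have := isq_ratio R (n - i) i; rewrite subnK ?leq_ord //.
  rewrite natrB ?leq_ord //; lra.
have cc : c0 c.
  apply/c0P => e /((c0P _).1 ch) [N HN]; exists N => n Nn.
  by rewrite /c fcoef_abs normr_id; exact: HN.
apply/(c0P (fun n => (h * b)$n / b$n - psum h n.+1)) => e e0.
(* The tail of c costs e / 6 times psum b n.+1 / (n b(n)) = (2n + 1) / n <= 3. Its head costs K / (n
   b(n)) <= 4 K b(n), whence the bound e / (8 (K + 1)) asked of b(n). Each part is at most e / 2. *)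
have [N HN] := (c0P _).1 cc (e / 6) (divr_gt0 e0 (ltr0Sn _ 5)).
pose K := psum c N.
have K0 : 0 <= K by apply: psum_ge0; exact: fabs_ge0.
have e8 : 0 < e / (8 * (K + 1)) by rewrite divr_gt0 // mulr_gt0 // ltr_wpDl.
have [N' HN'] := (c0P _).1 isq_c0 _ e8.
exists (maxn N.+1 N') => n; rewrite geq_max => /andP[Nn N'n].
have n0 : (0 < n)%N by lia.
rewrite {1}/fcoef; apply: le_trans (key n n0) _; have bn := isq_gt0 R n.
have n0' : 1 <= n%:R :> R by rewrite ler1n.
have H1 : (c * b)$n <= K + e / 6 * psum b n.+1.
  rewrite fcoefM -(subnKC (_ : N <= n.+1)%N); last lia.
  rewrite big_split_ord /=; apply: lerD.
    apply: ler_sum => i _; rewrite ler_piMr ?isq_le1 //; exact: fabs_ge0.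
  rewrite subnKC; last lia.
  apply: (@le_trans _ _ (\sum_(i < n.+1 - N) e / 6 * b$(n - (N + i))%N)).
    apply: ler_sum => i _; apply: ler_wpM2r; first exact/ltW/isq_gt0.
    by apply: le_trans (ler_norm _) (HN _ (leq_addr _ _)).
  rewrite -mulr_sumr; apply: ler_wpM2l; first lra.
  rewrite (reindex_inj rev_ord_inj) /=.
  apply: (@le_trans _ _ (psum b (n.+1 - N)%N)); last first.
    by apply: psum_homo; [move=> m; exact/ltW/isq_gt0|lia].
  apply: ler_sum => i _; rewrite le_eqVlt; apply/orP; left; apply/eqP; congr (_ $ _).
  by have := ltn_ord i; lia.
apply: (@le_trans _ _ ((K + e / 6 * psum b n.+1) / (n%:R * b$n))).
  by apply: ler_wpM2r => //; rewrite invr_ge0 mulr_ge0 // ltW.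
rewrite isq_sum mulrDl.
have H2 : K / (n%:R * b$n) <= e / 2.
  apply: (@le_trans _ _ (K * (4 * b$n))); first by apply: ler_wpM2l => //; exact: inv_isq.
  have := HN' n N'n; rewrite gtr0_norm // ler_pdivlMr ?mulr_gt0 // ?ltr_wpDl //.
  have := mulr_ge0 K0 (ltW bn); nra.
have -> : e / 6 * ((2 * n%:R + 1) * b$n) / (n%:R * b$n) = e / 6 * ((2 * n%:R + 1) / n%:R).
  by field; rewrite !gt_eqF // ltr0n.
have H3 : (2 * n%:R + 1) / n%:R <= 3 :> R.
  by rewrite ler_pdivrMr ?ltr0n //; lra.
have : e / 6 * ((2 * n%:R + 1) / n%:R) <= e / 6 * 3 by apply: ler_wpM2l => //; lra.
lra.
Qed.
End Transfer.

Local Open Scope complex_scope.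

(** * The dominant singularity *)

Section DominantRoot.
Variable R : realType.
Local Notation C := R[i].
Local Notation toC := (real_complex R).
Variables (D : {poly R}) (q : fps R).
Hypotheses (q0 : fnonneg q) (q00 : q$0 = 0) (q1 : 0 < q$1).
Hypothesis (qD : (1 - q) ^+ 2 = pfps D).
Hypothesis (Droots : forall z : C, root (map_poly toC D) z -> 1 <= `|z|).

Let qt N := ftrunc N q.
Let rest N := (1 - qt N) ^+ 2 - D.

(* Below degree N the coefficients cancel; above it D has none left. *)
Lemma rest_coef_ge0 N n : (size D < N)%N -> 0 <= (rest N)`_n.
Proof.
move=> DN; rewrite /rest coefB.
have -> : (1 - qt N) ^+ 2 = 1 - qt N - qt N + qt N * qt N by ring.
rewrite coefD !coefB coef1.
case: (ltnP n N) => nN.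
  have <- : ((1 - q) ^+ 2)$n = D`_n by rewrite qD.
  have -> : (1 - q) ^+ 2 = 1 - q - q + q * q by ring.
  rewrite fcoefD !fcoefB fcoef1 (fcoefM_trunc _ _ nN) /qt coef_ftrunc //.
  by rewrite subrr.
rewrite [D`_n]nth_default; last exact: leq_trans (ltnW DN) nN.
rewrite /qt [(ftrunc N q)`_n]nth_default; last by apply: leq_trans (size_poly _ _) _.
have -> : (n == 0%N) = false by rewrite gtn_eqF // (leq_trans _ nN) // (leq_trans _ DN).
rewrite !subr0 add0r coefM; apply: sumr_ge0 => i _.
by rewrite !coef_poly; apply: mulr_ge0; case: ifP.
Qed.

Lemma D0 : D.[0] = 1.
Proof.
rewrite horner_coef0; have := congr1 (fun a : fps R => a$0) qD.
by rewrite expr2 fcoefM0 fcoefB q00 fcoef1 subr0 mulr1 fcoef_pfps => <-.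
Qed.

Lemma D_neq0 x : 0 <= x < 1 -> D.[x] != 0.
Proof.
move=> /andP[x0 x1]; apply/negP => /eqP Dx.
have : root (map_poly toC D) x%:C by rewrite /root horner_map Dx /= rmorph0.
move=> /Droots; rewrite normc_def /= expr0n addr0 sqrtr_sqr ger0_norm //.
by rewrite (_ : 1 = 1%:C) // lecR; lra.
Qed.

Lemma poly_no_root_gt0 (p : {poly R}) x : 0 <= x -> 0 < p.[0] ->
  (forall y, 0 <= y < x -> p.[y] != 0) -> 0 <= p.[x].
Proof.
move=> x0 p0 H; rewrite leNgt; apply/negP => px.
have pp : p.[0] * p.[x] < 0 by rewrite pmulr_rlt0.
have [y] := poly_ivtoo x0 pp; rewrite in_itv /= => /andP[y0 yx] /rootP py.
by have := H y; rewrite py eqxx ltW // yx => /(_ isT).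
Qed.

Lemma D_ge0 x : 0 <= x <= 1 -> 0 <= D.[x].
Proof.
move=> /andP[x0 x1]; apply: poly_no_root_gt0 => // [|y /andP[y0 yx]].
  by rewrite D0.
by apply: D_neq0; rewrite y0 (lt_le_trans yx).
Qed.

Lemma horner_ge0 (p : {poly R}) x : (forall n, 0 <= p`_n) -> 0 <= x -> 0 <= p.[x].
Proof.
move=> p0 x0; rewrite horner_coef; apply: sumr_ge0 => i _.
by rewrite mulr_ge0 ?exprn_ge0.
Qed.

(** On [0, 1) the square of 1 - q_N is at least D > 0, so 1 - q_N cannot vanish there and keeps the
    sign it has at 0. *)
Lemma psum_q_le1_large N : (size D < N)%N -> psum q N <= 1.
Proof.
move=> DN; rewrite -subr_ge0 -ftrunc_horner1 -/(qt N).
have -> : 1 - (qt N).[1] = (1 - qt N).[1] by rewrite hornerD hornerN hornerC.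
have H x : (1 - qt N).[x] = 1 - (qt N).[x] by rewrite hornerD hornerN hornerC.
apply: poly_no_root_gt0 => // [|y /andP[y0 y1]].
  by rewrite H horner_coef0 coef_ftrunc ?q00 ?subr0 //; lia.
have := @horner_ge0 (rest N) y (fun n => rest_coef_ge0 n DN) y0.
rewrite /rest hornerD hornerN horner_exp subr_ge0 => HD.
have D_gt0 : 0 < D.[y] by rewrite lt_neqAle eq_sym D_neq0 ?D_ge0 ?y0 //= ?ltW.
apply/negP => /eqP E; move: HD; rewrite E expr0n /=.
by rewrite leNgt D_gt0.
Qed.

Lemma psum_q_le1 N : psum q N <= 1.
Proof.
apply: le_trans (@psum_q_le1_large (N + size D).+1 _); last by lia.
by apply: psum_homo => //; lia.
Qed.

Lemma Re_sum (I : Type) (r : seq I) (F : I -> C) :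
  complex.Re (\sum_(i <- r) F i) = \sum_(i <- r) complex.Re (F i).
Proof. by apply: (big_morph (@complex.Re R)) => // -[? ?] [? ?]. Qed.

(* [rest N] has nonnegative coefficients, hence |1 - q_N(z)|^2 <= (1 - q_N(1))^2 - D(1),
   while Re (1 - q_N(z)) >= 1 - q_N(1) + q_1 (1 - Re z): no limit is needed. *)
Lemma dominant_root z : root (map_poly toC D) z -> `|z| = 1 -> z = 1 /\ D.[1] = 0.
Proof.
move=> /rootP Dz z1; pose N := (size D).+2.
have DN : (size D < N)%N by [].
have Re_le1 (w : C) : `|w| = 1 -> complex.Re w <= 1.
  move=> w1; have := normc_ge_Re w; rewrite w1 (_ : 1 = 1%:C) // lecR.
  by apply: le_trans; exact: ler_norm.
pose w := (map_poly toC (1 - qt N)).[z].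
have wE : w = 1 - \sum_(i < N) (q$i)%:C * z ^+ i.
  rewrite /w rmorphB rmorph1 hornerD hornerN hornerC; congr (_ - _).
  rewrite (@horner_coef_wide _ N); last first.
    by rewrite size_map_poly; exact: size_poly.
  by apply: eq_bigr => i _; rewrite coef_map coef_ftrunc.
have Rew : 1 - psum q N + q$1 * (1 - complex.Re z) <= complex.Re w.
  have -> : complex.Re w = 1 - \sum_(i < N) q$i * complex.Re (z ^+ i).
    rewrite wE; have -> (a b : C) : complex.Re (a - b) = complex.Re a - complex.Re b.
      by case: a b => [? ?] [? ?].
    rewrite Re_sum; congr (_ - _); apply: eq_bigr => i _.
    by case: (z ^+ i) => x y /=; rewrite mul0r subr0.
  suff : q$1 * (1 - complex.Re z) <= \sum_(i < N) q$i * (1 - complex.Re (z ^+ i)).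
    have -> : \sum_(i < N) q$i * (1 - complex.Re (z ^+ i)) =
        psum q N - \sum_(i < N) q$i * complex.Re (z ^+ i).
      by rewrite /psum -sumrB; apply: eq_bigr => i _; rewrite mulrBr mulr1.
    by lra.
  rewrite (bigD1 (Ordinal (isT : (1 < N)%N))) //= expr1 lerDl.
  apply: sumr_ge0 => i _; apply: mulr_ge0 => //; rewrite subr_ge0; apply: Re_le1.
  by rewrite normrX z1 expr1n.
have w2 : complex.Re w ^+ 2 <= (rest N).[1].
  rewrite -lecR; apply: (@le_trans _ _ (`|w| ^+ 2)).
    have p0 : 0 <= `|complex.Re w|%:C by rewrite lecE /= eqxx normr_ge0.
    have := lerXn2r 2 p0 (normr_ge0 w) (normc_ge_Re w).
    by rewrite -rmorphXn /= real_normK ?num_real.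
  have -> : `|w| ^+ 2 = `|(map_poly toC (rest N)).[z]|.
    by rewrite /rest rmorphB rmorphXn /= hornerD hornerN Dz subr0 horner_exp normrX.
  rewrite !horner_coef size_map_poly rmorph_sum /=.
  apply: le_trans (ler_norm_sum _ _ _) _; apply: ler_sum => i _.
  rewrite normrM normrX z1 !expr1n !mulr1 coef_map /= ger0_norm ?ler0c //.
  exact: rest_coef_ge0.
have := psum_q_le1 N; rewrite -subr_ge0 => a0.
have b0 : 0 <= q$1 * (1 - complex.Re z).
  by apply: mulr_ge0; [exact: ltW|rewrite subr_ge0 Re_le1].
have restE : (rest N).[1] = (1 - psum q N) ^+ 2 - D.[1].
  by rewrite /rest hornerD hornerN horner_exp hornerD hornerN hornerC ftrunc_horner1.
have D1 : 0 <= D.[1] by apply: D_ge0; rewrite ler01 lexx.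
(* With s = 1 - q_N(1) and t = q_1 (1 - Re z), both nonnegative, (s + t)^2 <= s^2 - D(1) forces t =
   D(1) = 0. *)
have [bE D1E] : q$1 * (1 - complex.Re z) = 0 /\ D.[1] = 0.
  move: (q$1 * _) b0 Rew => t t0 Rew; move: (1 - psum q N) a0 Rew restE => s s0 Rew restE.
  move: (D.[1]) D1 restE => d d0 restE; rewrite restE in w2.
  move: (complex.Re w) Rew w2 => x x1 x2.
  have xx : (s + t) ^+ 2 <= x ^+ 2 by rewrite ler_pXn2r ?nnegrE //; lra.
  have stt : 0 <= s * t by exact: mulr_ge0.
  have t2 : 0 <= t ^+ 2 by exact: sqr_ge0.
  have : (s + t) ^+ 2 = s ^+ 2 + 2 * (s * t) + t ^+ 2 by ring.
  move=> E; split; last by lra.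
  by apply/eqP; rewrite -sqrf_eq0; apply/eqP; lra.
split=> //.
have Rez : complex.Re z = 1.
  by move/eqP: bE; rewrite mulf_eq0 gt_eqF //= subr_eq0 => /eqP.
have := add_Re2_Im2 z; rewrite z1 Rez !expr1n => /eqP.
rewrite (_ : 1 = 1%:C) // (inj_eq (@complexI R)) -subr_eq0 addrC addKr sqrf_eq0 => /eqP Imz.
by case: z Rez Imz {Dz z1 w wE Rew w2 b0 bE} => x y /= -> ->.
Qed.
End DominantRoot.

(** * Inverse square roots of polynomials with no root in the closed unit disc *)

Section SmoothRoot.
Variable R : realType.
Local Notation C := R[i].
Local Notation toC := (real_complex R).

Lemma smooth_dom (a v : fps R) : (forall n, `|a$n| <= v$n) -> smooth v -> smooth a.
Proof.
move=> av [lv cv]; split; first exact: l1_dom lv.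
apply/c0P => e /((c0P _).1 cv) [N HN]; exists N => n /HN; apply: le_trans.
rewrite !fcoef_theta !normrM ler_wpM2l //.
by apply: le_trans (av n) _; exact: ler_norm.
Qed.

Lemma smooth_scale_isq (t : R) : 0 <= t < 1 -> smooth (fscale t (isq R)).
Proof.
move=> /andP[t0 t1]; pose u := fC t * fX : fps R.
have u00 : u$0 = 0 by rewrite fcoefCM fcoefX mulr0.
apply: (@smooth_dom _ (finv1 u)); last first.
  apply: smooth_inv1 => //.
  - by apply: fnonnegM; [exact: fnonnegC|exact: fnonnegX].
  - by apply: smoothM; [exact: smoothC|exact: smoothX].
  - by rewrite fsumM ?fsumC ?fsumX ?mulr1 //; [exact: l1_C|exact: l1_X].
move=> n; have -> : (finv1 u)$n = t ^+ n.
  elim: n => [|n IH]; rewrite finv1E // fcoefD fcoef1 /u -mulrA fcoefCM fcoefXM.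
    by rewrite mulr0 addr0.
  by rewrite IH add0r exprS.
rewrite fcoef_scale normrM ger0_norm ?exprn_ge0 // ler_piMr ?exprn_ge0 //.
by rewrite gtr0_norm ?isq_gt0 // isq_le1.
Qed.

(** Smoothness is a property of real series, so the complex product of the dilated copies comes with
    a real majorant: the same product with each 1/z replaced by its modulus. *)
Lemma complex_inv_sqrt_majorant (rs : seq C) : (forall z, z \in rs -> 1 < `|z|) ->
  exists (e : fps C) (m : fps R),
  [/\ e ^+ 2 * pfps (\prod_(z <- rs) (1 - z^-1%:P * 'X)) = 1, e$0 = 1,
      smooth m & forall n, `|e$n| <= (m$n)%:C].
Proof.
elim: rs => [|z rs IH] rs1.
  exists 1, 1; split; rewrite ?big_nil ?rmorph1 ?expr1n ?mulr1 //; first exact: smooth1.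
  by move=> n; rewrite !fcoef1; case: eqP; rewrite ?normr1 ?normr0.
have [|e [m [eE e0 sm em]]] := IH; first by move=> y yr; apply: rs1; rewrite inE yr orbT.
have z1 : 1 < `|z| by apply: rs1; rewrite inE eqxx.
pose t := complex.Re `|z^-1|.
have tE : `|z^-1| = t%:C by rewrite /t RRe_real // normr_real.
have t01 : 0 <= t < 1.
  rewrite -ler0c -ltcR -tE normr_ge0 /= normfV invf_lt1 //.
  exact: lt_trans z1.
exists (fscale z^-1 (isq C) * e), (fscale t (isq R) * m); split.
- rewrite big_cons rmorphM /=.
  have -> : pfps (1 - z^-1%:P * 'X) = fscale z^-1 (1 - fX).
    rewrite [LHS]rmorphB [RHS]rmorphB /= fscaleX.
    by rewrite !rmorph1 rmorphM.
  rewrite exprMn mulrACA eE mulr1 -rmorphXn -rmorphM mulrC isq_sqr.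
  exact: rmorph1.
- by rewrite fcoefM0 e0 fcoef_scale isq0 !mulr1.
- by apply: smoothM => //; exact: smooth_scale_isq.
- move=> n; rewrite !fcoefM rmorph_sum /=; apply: le_trans (ler_norm_sum _ _ _) _.
  apply: ler_sum => i _; rewrite normrM rmorphM /=; apply: ler_pM => //.
  rewrite !fcoef_scale normrM normrX tE rmorphM rmorphXn /= ger0_norm; last exact/ltW/isq_gt0.
  rewrite le_eqVlt; apply/orP; left; apply/eqP; congr (_ * _).
  have -> : (isq C)$i = (fmap toC (isq R))$i; last by [].
  elim: (nat_of_ord i) => [|j IHj]; first by rewrite fcoef_map !isq0 rmorph1.
  rewrite isqS IHj !fcoef_map isqS rmorphM fmorph_div !rmorphD !rmorphM /=.
  by rewrite !rmorph_nat ?rmorph1.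
Qed.

Lemma smooth_inv_sqrt (H : {poly R}) (e : fps R) :
  e ^+ 2 * pfps H = 1 -> e$0 = 1 ->
  (forall z : C, root (map_poly toC H) z -> 1 < `|z|) -> smooth e.
Proof.
move=> eH e0 Hroots; set Hc := map_poly toC H.
have [rs HcE] := closed_field_poly_normal Hc.
have H0 : Hc.[0] = 1.
  have := congr1 (fun a : fps R => a$0) eH.
  rewrite expr2 !fcoefM0 e0 !mul1r fcoef1 fcoef_pfps => H0.
  by rewrite horner_coef0 coef_map /= H0 rmorph1.
have Hc0 : Hc != 0.
  by apply/eqP => E; move/eqP: H0; rewrite E horner0 eq_sym oner_eq0.
have lc0 : lead_coef Hc != 0 by rewrite lead_coef_eq0.
have rs1 z : z \in rs -> 1 < `|z|.
  move=> zr; apply: Hroots; rewrite -/Hc HcE rootZ //.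
  by rewrite root_prod_XsubC.
have rs0 z : z \in rs -> z != 0.
  by move/rs1 => z1; rewrite -normr_gt0 (lt_trans ltr01).
have HcP : Hc = \prod_(z <- rs) (1 - z^-1%:P * 'X).
  have E : \prod_(z <- rs) ('X - z%:P) =
     (\prod_(z <- rs) - z) *: \prod_(z <- rs) (1 - z^-1%:P * 'X).
    rewrite -mul_polyC rmorph_prod -big_split /=; apply: eq_big_seq => z /rs0 z0.
    rewrite polyCN mulNr mulrBr mulr1 mulrA -polyCM divff // mul1r opprB //.
  rewrite HcE E scalerA; set k := _ * _.
  suff -> : k = 1 by rewrite scale1r.
  have := H0; rewrite HcE E scalerA -/k hornerZ horner_prod big1 ?mulr1 // => z _.
  by rewrite hornerD hornerN hornerC hornerM hornerX mulr0 subr0.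
have [ec [m [ecE ec0 sm em]]] := complex_inv_sqrt_majorant rs1.
(* Both are square roots of 1 / H with constant term 1, so the real series e is the complex
   product. *)
have ee : fmap toC e = ec.
  apply: fsqrt_uniq; last first.
    by rewrite ec0 fcoef_map e0 rmorph1 -[1 + 1]/(2%:R) pnatr_eq0.
  apply: (@fmulIr _ _ _ (pfps Hc)); last first.
    by rewrite fcoef_pfps -horner_coef0 H0 oner_eq0.
  rewrite [in RHS]HcP ecE -rmorphXn -fmap_pfps -rmorphM eH.
  exact: rmorph1.
apply: (smooth_dom _ sm) => n.
have := em n; rewrite -ee fcoef_map normc_def /= expr0n addr0 sqrtr_sqr.
by rewrite lecR.
Qed.
End SmoothRoot.

(** * Asymptotics at a dominant singularity equal to 1 *)

Lemma smooth_renewal (R : realType) (y g u : fps R) : fnonneg u -> u$0 = 0 ->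
  smooth u -> fsum u < 1 -> smooth g -> y = g + u * y -> smooth y.
Proof.
move=> u0 u00 su u1 sg yE.
have -> : y = g * finv1 u.
  have H : (1 - u) * finv1 u = 1 by rewrite mulrBl mul1r {1}finv1E //; ring.
  have H2 : (1 - u) * y = g by rewrite mulrBl mul1r {1}yE; ring.
  by rewrite -H2 mulrAC H mul1r.
by apply: smoothM => //; exact: smooth_inv1.
Qed.

Section SumsTo.
Variable R : realType.
Implicit Types a b : fps R.
(** Summability and value together let [sum_tac] read the value off the shape of an expression;
    [sums_toE] then turns an identity of series into one of numbers. *)
Definition sums_to a v := l1 a /\ fsum a = v.
Lemma sums_toE a v w : sums_to a v -> sums_to a w -> v = w.
Proof. by case=> _ <- []. Qed.
Lemma sums_to_fsum a : l1 a -> sums_to a (fsum a). Proof. by []. Qed.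
Lemma sums_toD a b v w : sums_to a v -> sums_to b w -> sums_to (a + b) (v + w).
Proof. by move=> [la <-] [lb <-]; split; [exact: l1D|exact: fsumD]. Qed.
Lemma sums_toB a b v w : sums_to a v -> sums_to b w -> sums_to (a - b) (v - w).
Proof. by move=> [la <-] [lb <-]; split; [exact: l1B|exact: fsumB]. Qed.
Lemma sums_toM a b v w : sums_to a v -> sums_to b w -> sums_to (a * b) (v * w).
Proof. by move=> [la <-] [lb <-]; split; [exact: l1M|exact: fsumM]. Qed.
Lemma sums_toX a v n : sums_to a v -> sums_to (a ^+ n) (v ^+ n).
Proof. by move=> [la <-]; split; [exact: l1_exp|exact: fsum_exp]. Qed.
Lemma sums_to_nat n : sums_to n%:R n%:R.
Proof. by split; [exact: l1_nat|exact: fsum_nat]. Qed.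
Lemma sums_to1 : sums_to 1 1. Proof. by split; [exact: l1_1|exact: fsum1]. Qed.
Lemma sums_to_pfps p : sums_to (pfps p) p.[1].
Proof. by split; [exact: l1_pfps|exact: fsum_pfps]. Qed.
End SumsTo.

Ltac sum_tac := lazymatch goal with
  | |- sums_to (_ - _) _ => apply: sums_toB; sum_tac
  | |- sums_to (_ + _) _ => apply: sums_toD; sum_tac
  | |- sums_to (_ * _) _ => apply: sums_toM; sum_tac
  | |- sums_to (_ ^+ _) _ => apply: sums_toX; sum_tac
  | |- sums_to (_%:R) _ => exact: sums_to_nat
  | |- sums_to 1 _ => exact: sums_to1
  | |- _ => assumption
  end.
Ltac smooth_tac := lazymatch goal with
  | |- smooth (_ - _) => apply: smoothB; smooth_tac
  | |- smooth (_ + _) => apply: smoothD; smooth_tac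
  | |- smooth (_ * _) => apply: smoothM; smooth_tac
  | |- smooth (_ ^+ _) => apply: smooth_exp; smooth_tac
  | |- smooth (_%:R) => exact: smooth_nat
  | |- smooth 1 => exact: smooth1
  | |- _ => assumption
  end.
(** A difference is an atom, to be found among the hypotheses; its case precedes that of sums
    because a - b is a + - b. *)
Ltac nonneg_tac := lazymatch goal with
  | |- fnonneg (_ + - _) => assumption
  | |- fnonneg (_ + _) => apply: fnonnegD; nonneg_tac
  | |- fnonneg (_ * _) => apply: fnonnegM; nonneg_tac
  | |- fnonneg (_%:R) => exact: fnonneg_nat
  | |- _ => assumption
  end.

(* The values at the dominant singularity rho: sg, r, m, f, x stand for
   S(rho), R(rho), M(rho), F(rho), X(rho). *)
Record singular_values (R : realFieldType) (k : nat) (rho sg r m f x : R) : Prop := {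
  sv_rho : 0 < rho;
  sv_sg : 0 <= sg;
  sv_sgr : sg <= r;
  sv_m : 0 < m;
  sv_f : 0 < f;
  sv_x : 0 <= x;
  sv_sgf : k%:R * sg <= rho * f;
  sv_sgx : k%:R ^+ 2 * sg <= rho * x;
  sv_req : 1 - rho + 2 * rho * sg = 4 * rho * r;
  sv_deq : (1 - rho + 2 * rho * sg) ^+ 2 = 8 * rho ^+ 2 * (k.+1%:R + sg ^+ 2);
  sv_meq : m = k%:R * rho + 2 * rho * r * m;
  sv_feq : f * (rho * m) = k%:R * rho - 2 * k%:R * rho * sg * (r - sg);
  sv_xeq : x * (rho + 2 * rho * m) =
    k%:R * rho + rho * f ^+ 2 + 2 * rho * (f - k%:R * sg) ^+ 2 }.

(** [sing_num] is G(rho), and [sing_den] is - theta D(rho) simplified by D(rho) = 0. *)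
Definition sing_num (R : realFieldType) (k : nat) (rho sg r f x : R) : R :=
  rho * x + rho * f ^+ 2 - 2 * rho * k%:R ^+ 2 * sg * (r - sg).
Definition sing_den (R : realFieldType) (k : nat) (rho sg : R) : R :=
  2 * (1 - rho + 2 * rho * sg) * (1 - 4 * k%:R * rho * sg) + 32 * k%:R * rho ^+ 2 * sg ^+ 2.

(** * Inequalities between the values at the singularity *)

Section SingularFacts.
Variables (R : realFieldType) (k : nat) (rho sg r m f x : R).
Hypothesis (k2 : (2 <= k)%N) (sv : singular_values k rho sg r m f x).

Let k2' : 2 <= k%:R :> R. Proof. by rewrite ler_nat. Qed.

Lemma sv_m_ge : k%:R * rho <= m.
Proof.
case: sv => rho0 sg0 sgr m0 _ _ _ _ _ _ mE _ _; rewrite {1}mE lerDl.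
have r0 : 0 <= r := le_trans sg0 sgr.
by rewrite !mulr_ge0 // ltW.
Qed.
Lemma sv_rf_le1 : rho * f <= 1.
Proof.
have H := sv_m_ge; case: sv => rho0 sg0 sgr m0 f0 _ _ _ _ _ _ fE _.
have : f * (rho * m) <= k%:R * rho.
  by rewrite fE lerBlDr lerDl !mulr_ge0 ?subr_ge0 // ltW.
move=> H2; rewrite -(ler_pM2r m0) mul1r; apply: le_trans H; apply: le_trans H2.
by rewrite mulrA [f * _]mulrC.
Qed.
(** The comparison of S with z F caps the Sigma-star contribution, whatever s and rho are. *)
Lemma sv_ksg_le1 : k%:R * sg <= 1.
Proof. by apply: le_trans sv_rf_le1; case: sv. Qed.
Lemma sv_sg_le : sg <= 1 / 2.
Proof. by have H := sv_ksg_le1; have := sv_sg sv; move: k2' H; nra. Qed.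
Lemma sv_rho_le : 8 * rho ^+ 2 * k.+1%:R <= 1.
Proof.
have H := sv_sg_le; have sg0 := sv_sg sv; have r0 := sv_rho sv.
have a0 : 0 <= 1 - rho + 2 * rho * sg.
  have rr0 : 0 <= r := le_trans sg0 (sv_sgr sv).
  by rewrite (sv_req sv) !mulr_ge0 // ltW.
have a1 : 1 - rho + 2 * rho * sg <= 1 by nra.
have := sv_deq sv; have : (1 - rho + 2 * rho * sg) ^+ 2 <= 1 by rewrite exprn_ile1.
have : 0 <= 8 * rho ^+ 2 * sg ^+ 2 by rewrite !mulr_ge0 // ltW.
lra.
Qed.
Lemma sv_rho_lt : rho < 1 / 4.
Proof.
have := sv_rho_le; have r0 := sv_rho sv; have k3 : 3 <= k.+1%:R :> R by rewrite ler_nat.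
have : 0 <= rho ^+ 2 by rewrite sqr_ge0.
by move=> H H2; nra.
Qed.
(** This is the simplicity of the root: k sg <= 1 and rho < 1/4 keep 1 - 4 k rho sg positive. *)
Lemma sing_den_gt0 : 0 < sing_den k rho sg.
Proof.
have r4 := sv_rho_lt; have ks := sv_ksg_le1; have r0 := sv_rho sv; have sg0 := sv_sg sv.
have rsg : 0 <= rho * sg by rewrite mulr_ge0 // ltW.
rewrite /sing_den; apply: ltr_wpDr; first by rewrite !mulr_ge0 // ltW.
apply: mulr_gt0; first by nra.
have : k%:R * sg * rho <= 1 * rho by rewrite ler_wpM2r // ltW.
by lra.
Qed.
(** As 2 rho (r - sg) <= 1, the negative term is at most k^2 sg <= rho x, and rho f^2 > 0
    remains. *)
Lemma sing_num_gt0 : 0 < sing_num k rho sg r f x.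
Proof.
have r0 := sv_rho sv; have sg0 := sv_sg sv; have sgr := sv_sgr sv.
have f2 : 0 < rho * f ^+ 2 by rewrite mulr_gt0 // exprn_gt0 // (sv_f sv).
have H : 2 * rho * (r - sg) <= 1.
  have := sv_req sv; have : 0 <= rho * sg by rewrite mulr_ge0 // ltW.
  have := mulr_ge0 (ltW r0) (le_trans sg0 sgr).
  lra.
have : k%:R ^+ 2 * sg * (2 * rho * (r - sg)) <= k%:R ^+ 2 * sg * 1.
  by apply: ler_wpM2l => //; rewrite mulr_ge0 // sqr_ge0.
have := sv_sgx sv; rewrite /sing_num; lra.
Qed.
End SingularFacts.

Section Normalized.
Variable R : realType.
Local Notation C := R[i].
Local Notation toC := (real_complex R).
Variables (k : nat) (rho sg : R).
Hypotheses (k2 : (2 <= k)%N) (rho0 : 0 < rho) (sg0 : 0 <= sg).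
(* Auxiliary series are variables with a defining equation rather than [Let]s, so that
   unification cannot unfold them. *)
Variables Z S : fps R.
Hypotheses (Zd : Z = fC rho * fX) (Sd : S = fC sg * fX ^+ (2 * k)).
Let Zp : {poly R} := rho%:P * 'X.
Let Sp : {poly R} := sg%:P * 'X ^+ (2 * k).
(** The polynomial D(rho z), with sg standing for s rho^(2k); at rho = 1 and sg = s it is D
    itself. *)
Definition discr : {poly R} :=
  (1 - Zp + 2 * Zp * Sp) ^+ 2 - 8 * Zp ^+ 2 * (k.+1%:R + Sp ^+ 2).
Variables r m f x e : fps R.
Hypothesis rE : r = k.+1%:R * Z + Z * r + Z * r ^+ 2 + Z * (r - S) ^+ 2.
Hypothesis mE : m = k%:R * Z + 2 * Z * r * m.
Hypothesis fE : f = k%:R * Z + Z * f + Z * f * r + Z * (r - m) * f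
  + 2 * Z * (f - k%:R * S) * (r - S).
Hypothesis xE : x = k%:R * Z + Z * f ^+ 2 + 2 * Z * (r - m) * x
  + 2 * Z * x * (r - S) + 2 * Z * (f - k%:R * S) ^+ 2.
Hypothesis eE : e = Z * (e + x) + Z * (2 * e * r + f ^+ 2)
  + 2 * Z * (e - k%:R ^+ 2 * S) * (r - S).
Hypotheses (m0 : fnonneg m) (f0 : fnonneg f) (x0 : fnonneg x).
Hypotheses (Sr : forall n, S$n <= r$n) (mr : forall n, m$n <= r$n).
Hypothesis Sf : forall n, k%:R * S$n <= (Z * f)$n.
Hypothesis Sx : forall n, k%:R ^+ 2 * S$n <= (Z * x)$n.
Hypothesis roots_ge1 : forall z : C, root (map_poly toC discr) z -> 1 <= `|z|.
Hypothesis root1 : exists2 z : C, root (map_poly toC discr) z & `|z| = 1.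

Let Z0 : fnonneg Z.
Proof. by rewrite Zd; apply: fnonnegM; [apply: fnonnegC; exact: ltW|exact: fnonnegX]. Qed.
Let S0 : fnonneg S.
Proof. by rewrite Sd; apply: fnonnegM; [exact: fnonnegC|apply: fnonneg_exp; exact: fnonnegX]. Qed.
Let r0 : fnonneg r. Proof. by move=> n; exact: le_trans (S0 n) (Sr n). Qed.
Let rS0 : fnonneg (r - S). Proof. by move=> n; rewrite fcoefB subr_ge0. Qed.
Let rm0 : fnonneg (r - m). Proof. by move=> n; rewrite fcoefB subr_ge0. Qed.
Let coefZM a n : (Z * a)$n = if n is n'.+1 then rho * a$n' else 0.
Proof. by rewrite Zd -mulrA fcoefCM fcoefXM; case: n => [|n]; rewrite ?mulr0. Qed.
Let sZ : smooth Z. Proof. by rewrite Zd; apply: smoothM; [exact: smoothC|exact: smoothX]. Qed.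
Let sS : smooth S.
Proof. by rewrite Sd; apply: smoothM; [exact: smoothC|apply: smooth_exp; exact: smoothX]. Qed.
Let lZ : l1 Z. Proof. by case: sZ. Qed.
Let lS : l1 S. Proof. by case: sS. Qed.
Let hZ : sums_to Z rho.
Proof. by split=> //; rewrite Zd fsumM ?fsumC ?fsumX ?mulr1 //; [exact: l1_C|exact: l1_X]. Qed.
Let hS : sums_to S sg.
Proof.
split=> //; rewrite Sd fsumM ?fsum_exp ?fsumC ?fsumX ?expr1n ?mulr1 //;
  by [exact: l1_X|exact: l1_C|apply: l1_exp; exact: l1_X].
Qed.
Let thZ : ftheta Z = Z.
Proof. by rewrite Zd fthetaM fthetaC fthetaX mul0r add0r. Qed.
Let thS : ftheta S = (2 * k)%:R * S.
Proof. by rewrite Sd fthetaM fthetaC fthetaXX mul0r add0r mulrCA. Qed.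

Let sumZ : fsum Z = rho. Proof. by case: hZ. Qed.
Let sumS : fsum S = sg. Proof. by case: hS. Qed.

Let discrE : pfps discr = (1 - Z + 2 * Z * S) ^+ 2 - 8 * Z ^+ 2 * (k.+1%:R + S ^+ 2).
Proof.
have -> : Z = pfps Zp by rewrite Zd /Zp rmorphM.
have -> : S = pfps Sp by rewrite Sd /Sp rmorphM rmorphXn.
by rewrite /discr !(rmorphB, rmorphXn, rmorphM, rmorphD, rmorph1, rmorph_nat).
Qed.

Variable q : fps R.
Hypothesis qd : q = Z + 4 * Z * r - 2 * Z * S.

Let qq : (1 - q) ^+ 2 = pfps discr.
Proof.
have -> : (1 - q) ^+ 2 = pfps discr + 8 * Z *
   (k.+1%:R * Z + Z * r + Z * r ^+ 2 + Z * (r - S) ^+ 2 - r).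
  by rewrite discrE qd; ring.
by rewrite [X in X - r](esym rE) subrr mulr0 addr0.
Qed.

Let coefq n : q$n.+1 = rho * ((n == 0%N)%:R + 4 * r$n - 2 * S$n).
Proof.
have -> : q = Z * (1 + fC 4 * r - fC 2 * S) by rewrite !fC_nat qd; ring.
by rewrite coefZM fcoefB fcoefD 2!fcoefCM fcoef1.
Qed.
Let q00 : q$0 = 0.
Proof.
have -> : q = Z * (1 + 4 * r - 2 * S) by rewrite qd; ring.
by rewrite coefZM.
Qed.
Let q0 : fnonneg q.
Proof.
have -> : q = Z + 2%:R * Z * r + 2%:R * Z * (r - S) by rewrite qd; ring.
by nonneg_tac.
Qed.
Let S00 : S$0 = 0.
Proof. by rewrite Sd fcoefCM fcoefXX; case: k k2 => //= j _; rewrite mulr0. Qed.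
Let r00 : r$0 = 0.
Proof.
by rewrite rE Zd !fcoefD !fcoefM0 fcoefX !(mulr0, mul0r, addr0).
Qed.
Let q1 : 0 < q$1.
Proof.
by rewrite coefq r00 S00 !mulr0 subr0 addr0 mulr1.
Qed.

Let q_le1 N : psum q N <= 1.
Proof. exact: (psum_q_le1 q0 q00 q1 qq roots_ge1). Qed.
Let lq : l1 q. Proof. exact: (l1_nonneg q0 q_le1). Qed.
Let dom z : root (map_poly toC discr) z -> `|z| = 1 -> z = 1 /\ discr.[1] = 0.
Proof. exact: (dominant_root q0 q00 q1 qq roots_ge1). Qed.
Let discr1 : discr.[1] = 0.
Proof. by have [z rz z1] := root1; have [] := dom rz z1. Qed.
Let sumq : fsum q = 1.
Proof.
have : fsum ((1 - q) ^+ 2) = 0 by rewrite qq fsum_pfps.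
have l1q : l1 (1 - q) by apply: l1B => //; exact: l1_1.
rewrite fsum_exp // fsumB ?fsum1 //; last exact: l1_1.
by move/eqP; rewrite sqrf_eq0 subr_eq0 => /eqP.
Qed.
Let lr : l1 r.
Proof.
(* As S <= r coefficientwise, q(n+1) is at least 2 rho r(n), and the partial sums of q are at most
   1. *)
apply: (@l1_nonneg _ _ (1 / (2 * rho))) => // N.
rewrite ler_pdivlMr ?mulr_gt0 //; apply: le_trans (q_le1 N.+1).
rewrite /psum big_ord_recl q00 add0r mulr_suml; apply: ler_sum => i _.
rewrite lift0 coefq.
have := Sr i; have := r0 i; have : 0 <= (nat_of_ord i == 0%N)%:R :> R by [].
move=> h1 h2 h3; have -> : r$i * (2 * rho) = rho * (2 * r$i) by ring.
by rewrite ler_pM2l //; lra.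
Qed.
Let lm : l1 m.
Proof. by apply: l1_dom lr => n; rewrite ger0_norm. Qed.

Local Notation rr := (fsum r).
Local Notation mm := (fsum m).
Let hq : sums_to q 1. Proof. by []. Qed.
Let hr : sums_to r rr. Proof. by []. Qed.
Let hm : sums_to m mm. Proof. by []. Qed.
Let req : 1 - rho + 2 * rho * sg = 4 * rho * rr.
Proof.
have : 1 = rho + 4 * rho * rr - 2 * rho * sg.
  by apply: (sums_toE hq); rewrite qd; sum_tac.
lra.
Qed.
Let deq : (1 - rho + 2 * rho * sg) ^+ 2 = 8 * rho ^+ 2 * (k.+1%:R + sg ^+ 2).
Proof.
apply: subr0_eq; rewrite -discr1; apply: (sums_toE _ (sums_to_pfps _)).
by rewrite discrE; sum_tac.
Qed.
Let meq : mm = k%:R * rho + 2 * rho * rr * mm.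
Proof. by apply: (sums_toE hm); rewrite {1}mE; sum_tac. Qed.
Let mm_gt0 : 0 < mm.
Proof.
rewrite meq; apply: ltr_pwDl; first by rewrite mulr_gt0 // ltr0n; lia.
have rr0 : 0 <= rr by exact: fsum_ge0.
have mm0 : 0 <= mm by exact: fsum_ge0.
by rewrite !mulr_ge0 // ltW.
Qed.
Variable u : fps R.
Hypothesis ud : u = Z + Z * r + Z * (r - m) + 2%:R * Z * (r - S).
Let u0 : fnonneg u.
Proof. by rewrite ud; nonneg_tac. Qed.
(** The kernel of the equation of f. Although q sums to 1, the non-nullable expressions bring this
    sum below 1, so F stays finite at the singularity. *)
Let uE : u = q - Z * m. Proof. by rewrite ud qd; ring. Qed.
Let hu : sums_to u (1 - rho * mm). Proof. by rewrite uE; sum_tac. Qed.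
Let sumu : fsum u = 1 - rho * mm.
Proof. by case: hu. Qed.
Let u1 : fsum u < 1. Proof. by rewrite sumu ltrBlDr ltrDl mulr_gt0. Qed.
Variable g : fps R.
Hypothesis gd : g = k%:R * Z - 2 * k%:R * S * (Z * r) + 2 * k%:R * Z * S ^+ 2.
Let fE' : f = g + u * f.
Proof. by rewrite {1}fE gd ud; ring. Qed.
Let lf : l1 f.
Proof.
have hg : sums_to g (k%:R * rho - 2 * k%:R * sg * (rho * rr) + 2 * k%:R * rho * sg ^+ 2).
  by rewrite gd; sum_tac.
by apply: (l1_renewal f0 u0 hu.1 hg.1 u1) => n; rewrite -fcoefD -fE'.
Qed.
Local Notation ff := (fsum f).
Let hf : sums_to f ff. Proof. by []. Qed.
Let feq : ff * (rho * mm) = k%:R * rho - 2 * k%:R * rho * sg * (rr - sg).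
Proof.
have : ff = k%:R * rho - 2 * k%:R * sg * (rho * rr) + 2 * k%:R * rho * sg ^+ 2
    + (1 - rho * mm) * ff.
  apply: (sums_toE hf); rewrite {1}fE'; apply: sums_toD; last by sum_tac.
  by rewrite gd; sum_tac.
lra.
Qed.
Let sgf : k%:R * sg <= rho * ff.
Proof.
have h1 : sums_to (k%:R * S) (k%:R * sg) by sum_tac.
have h2 : sums_to (Z * f) (rho * ff) by sum_tac.
rewrite -h1.2 -h2.2; apply: le_fsum h1.1 h2.1 _ => n.
by rewrite -fC_nat fcoefCM.
Qed.
Let ff_gt0 : 0 < ff.
Proof.
have : 0 <= ff by exact: fsum_ge0.
rewrite le_eqVlt => /orP[/eqP ff0|//]; move: sgf feq; rewrite -ff0 mulr0 mul0r => h1 h2.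
have k0 : 0 < k%:R :> R by rewrite ltr0n; lia.
have sgE : sg = 0.
  by apply/eqP; rewrite eq_le sg0 andbT -(ler_pM2l k0) mulr0.
move: h2; rewrite sgE mulr0 mul0r subr0 => /eqP; rewrite eq_sym mulf_eq0 !gt_eqF //.
Qed.

(** Smoothness passes from q to the product Z r by linearity, not to r itself; hence the equations
    are arranged so that r occurs only multiplied by Z. *)
Variable y : fps R.
Hypothesis yd : y = Z * r.
Let y0 : fnonneg y. Proof. by rewrite yd; exact: fnonnegM. Qed.
Let yE : y = fC (1 / 4) * (q - Z + 2 * Z * S).
Proof.
have -> : q - Z + 2 * Z * S = 4 * y by rewrite qd yd; ring.
by rewrite mulrA -fC_nat -fCM (_ : 1 / 4 * 4 = 1 :> R) ?(fC_nat R 1) ?mul1r //; field.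
Qed.
Let y00 : y$0 = 0. Proof. by rewrite yd coefZM. Qed.

Let lx : l1 x.
Proof.
have hux : sums_to (2%:R * Z * (r - m) + 2%:R * Z * (r - S))
  (2 * rho * (rr - mm) + 2 * rho * (rr - sg)) by sum_tac.
have hgx : sums_to (k%:R * Z + Z * f ^+ 2 + 2 * Z * (f - k%:R * S) ^+ 2)
  (k%:R * rho + rho * ff ^+ 2 + 2 * rho * (ff - k%:R * sg) ^+ 2) by sum_tac.
apply: (l1_renewal x0 _ hux.1 hgx.1); first by nonneg_tac.
  (* By [req] this kernel sums to 1 - rho - 2 rho mm. *)
  by rewrite hux.2; have := mulr_gt0 rho0 mm_gt0; have := req; have := rho0; lra.
move=> n; rewrite -fcoefD {1}xE le_eqVlt; apply/orP; left; apply/eqP.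
by congr (_ $ _); ring.
Qed.
Local Notation xx := (fsum x).
Let xeq : xx * (rho + 2 * rho * mm) =
    k%:R * rho + rho * ff ^+ 2 + 2 * rho * (ff - k%:R * sg) ^+ 2.
Proof.
have hx : sums_to x xx by [].
have h : xx = k%:R * rho + rho * ff ^+ 2 + 2 * rho * (rr - mm) * xx
    + 2 * rho * xx * (rr - sg) + 2 * rho * (ff - k%:R * sg) ^+ 2.
  by apply: (sums_toE hx); rewrite {1}xE; sum_tac.
apply/eqP; rewrite -subr_eq0; apply/eqP.
transitivity (xx - (k%:R * rho + rho * ff ^+ 2 + 2 * rho * (rr - mm) * xx
    + 2 * rho * xx * (rr - sg) + 2 * rho * (ff - k%:R * sg) ^+ 2)
  + xx * (4 * rho * rr - (1 - rho + 2 * rho * sg))); first by ring.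
by rewrite req subrr mulr0 addr0 {1}h subrr.
Qed.
Let sgx : k%:R ^+ 2 * sg <= rho * xx.
Proof.
have hx : sums_to x xx by [].
have h1 : sums_to (k%:R ^+ 2 * S) (k%:R ^+ 2 * sg) by sum_tac.
have h2 : sums_to (Z * x) (rho * xx) by sum_tac.
rewrite -h1.2 -h2.2; apply: le_fsum h1.1 h2.1 _ => n.
by rewrite -natrX -fC_nat fcoefCM natrX.
Qed.

Lemma normalized_values : singular_values k rho sg rr mm ff xx.
Proof.
split=> //; last exact: fsum_ge0.
by rewrite -sumS; apply: le_fsum.
Qed.
Let sv := normalized_values.

Let dd := sing_den k rho sg.
Let thD : ftheta (pfps discr) =
  2 * (1 - Z + 2 * Z * S) * (2 * Z * S + 4 * k%:R * Z * S - Z)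
  - 16 * Z ^+ 2 * (k.+1%:R + S ^+ 2) - 32 * k%:R * Z ^+ 2 * S ^+ 2.
Proof.
have thn n (a : fps R) : ftheta (n%:R * a) = n%:R * ftheta a.
  by rewrite fthetaM ftheta_nat mul0r add0r.
have th2 (a : fps R) : ftheta (a ^+ 2) = 2 * (a * ftheta a).
  by rewrite expr2 fthetaM; ring.
have thA (a b : fps R) : ftheta (a + b) = ftheta a + ftheta b by exact: raddfD.
have thB (a b : fps R) : ftheta (a - b) = ftheta a - ftheta b by exact: raddfB.
have -> : pfps discr = (1 - Z + 2%:R * (Z * S)) ^+ 2
   - 8%:R * (Z ^+ 2 * (k.+1%:R + S ^+ 2)) by rewrite discrE; ring.
rewrite thB th2 thA thB ftheta1 !thn fthetaM [ftheta (Z ^+ 2 * _)]fthetaM thA ftheta_nat.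
by rewrite !th2 thZ thS natrM; ring.
Qed.
Let sthD : smooth (ftheta (pfps discr)).
Proof. by rewrite thD; smooth_tac. Qed.
Let sum_thD : fsum (ftheta (pfps discr)) = - dd.
Proof.
transitivity (2 * (1 - rho + 2 * rho * sg) * (2 * rho * sg + 4 * k%:R * rho * sg - rho) -
  16 * rho ^+ 2 * (k.+1%:R + sg ^+ 2) - 32 * k%:R * rho ^+ 2 * sg ^+ 2).
  suff [] : sums_to (ftheta (pfps discr)) (2 * (1 - rho + 2 * rho * sg) *
    (2 * rho * sg + 4 * k%:R * rho * sg - rho) -
    16 * rho ^+ 2 * (k.+1%:R + sg ^+ 2) - 32 * k%:R * rho ^+ 2 * sg ^+ 2) by [].
  by rewrite thD; sum_tac.
have -> : 16 * rho ^+ 2 * (k.+1%:R + sg ^+ 2) =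
  2 * (8 * rho ^+ 2 * (k.+1%:R + sg ^+ 2)) by ring.
rewrite /dd /sing_den.
by rewrite -deq; ring.
Qed.

Variable W : fps R.
Hypothesis Wd : W = finv1 q.
Let WE : W * (1 - q) = 1.
Proof. by rewrite mulrBr mulr1 {1}Wd finv1E //; rewrite -Wd; ring. Qed.
(** W is 1 / sqrt D and [(1 - fX) * isq R] is (1 - z)^(1/2), so [eta] is the factor H^(-1/2), and W
    is [eta] times (1 - z)^(-1/2). *)
Variable eta : fps R.
Hypothesis etad : eta = (1 - fX) * isq R * W.
Let WbE : W = eta * isq R.
Proof.
have -> : eta * isq R = (1 - fX) * isq R ^+ 2 * W by rewrite etad; ring.
by rewrite isq_sqr mul1r.
Qed.

Let eta_facts : smooth eta /\ fsum eta != 0.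
Proof.
have /factor_theorem [H' HE] : root discr 1 by rewrite /root discr1.
pose H := - H'.
have DH : pfps discr = (1 - fX) * pfps H.
  by rewrite HE /H rmorphM rmorphB rmorphN rmorph1 -/fX; ring.
have etaH : eta ^+ 2 * pfps H = 1.
  have -> : eta ^+ 2 * pfps H = ((1 - fX) * isq R ^+ 2) * (W ^+ 2 * ((1 - fX) * pfps H)).
    by rewrite etad; ring.
  by rewrite isq_sqr mul1r -DH -qq -exprMn WE expr1n.
have lH : l1 (pfps H) by exact: l1_pfps.
have lX : l1 (fX : fps R) by exact: l1_X.
have H1 : H.[1] = dd.
  have E : ftheta (pfps discr) = (1 - fX) * ftheta (pfps H) - fX * pfps H.
    by rewrite DH fthetaM raddfB /= ftheta1 fthetaX; ring.
  have hth : sums_to (ftheta (pfps H)) H^`().[1].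
    have -> : ftheta (pfps H) = pfps ('X * H^`()).
      apply/fpsP => -[|n]; rewrite fcoef_theta !fcoef_pfps coefXM ?mul0r //=.
      by rewrite coef_deriv mulr_natl.
    by rewrite -[H^`().[1]]mul1r -{1}(hornerX (1 : R)) -hornerM; exact: sums_to_pfps.
  have hX : sums_to (fX : fps R) 1 by split; [exact: l1_X|exact: fsumX].
  have hH := sums_to_pfps H.
  have hD : sums_to (ftheta (pfps discr)) ((1 - 1) * H^`().[1] - 1 * H.[1]).
    by rewrite E; sum_tac.
  have := hD.2; rewrite sum_thD; lra.
have dd0 : 0 < dd by exact: sing_den_gt0 sv.
have se : smooth eta.
  apply: (smooth_inv_sqrt etaH).
    rewrite etad !fcoefM0 isq0 fcoefB fcoef1 fcoefX subr0 !mul1r.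
    by rewrite Wd finv1E // fcoefD fcoefM0 q00 mul0r addr0.
  move=> z rz; have rDz : root (map_poly toC discr) z.
    by rewrite HE rmorphM /= rootM; rewrite /H rmorphN rootN in rz; rewrite rz.
  (* A root of H of modulus 1 would be 1 by [dom], but H(1) = dd > 0. *)
  rewrite lt_neqAle roots_ge1 // andbT; apply/negP => /eqP/esym z1.
  have [zE _] := dom rDz z1; move: rz; rewrite zE -(rmorph1 toC) /root horner_map H1.
  by rewrite fmorph_eq0 gt_eqF.
split=> //; apply/negP => /eqP e0.
have heta : sums_to eta 0 by rewrite -e0; apply: sums_to_fsum; case: se.
have hH := sums_to_pfps H.
have : 0 ^+ 2 * H.[1] = 1.
  by apply: (sums_toE _ (@sums_to1 R)); rewrite -[X in sums_to X]etaH; sum_tac.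
by move/eqP; rewrite expr0n mul0r eq_sym oner_eq0.
Qed.
Let se : smooth eta. Proof. by case: eta_facts. Qed.
Let le : l1 eta. Proof. by case: se. Qed.
Local Notation h := (fsum eta).

Let q_asymp : (fun n => (2 * ftheta q)$n / (isq R)$n) @ \oo --> dd * h.
Proof.
have -> : 2 * ftheta q = - ftheta (pfps discr) * eta * isq R.
  have : ftheta ((1 - q) ^+ 2) = - (2 * (1 - q) * ftheta q).
    by rewrite expr2 fthetaM raddfB /= ftheta1; ring.
  rewrite qq => ->; rewrite opprK -[RHS]mulrA -WbE.
  by transitivity (W * (1 - q) * (2 * ftheta q)); [rewrite WE mul1r|ring].
have -> : - ftheta (pfps discr) * eta = (0%:R - ftheta (pfps discr)) * eta.
  by rewrite sub0r.
have heta : sums_to eta h by [].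
have hth : sums_to (ftheta (pfps discr)) (- dd) by split=> //; case: sthD.
have <- : fsum ((0%:R - ftheta (pfps discr)) * eta) = dd * h.
  have hh : sums_to ((0%:R - ftheta (pfps discr)) * eta) ((0%:R - - dd) * h) by sum_tac.
  by rewrite hh.2 sub0r opprK.
by apply: smooth_transfer; smooth_tac.
Qed.

(** The bootstrap: theta q is asymptotically a multiple of b(n), which tends to 0. This is the
    missing half of smoothness. *)
Let sq : smooth q.
Proof.
split=> //; apply/c0P.
have H : (fun n => (2 * ftheta q)$n / (isq R)$n * (isq R)$n) @ \oo --> (dd * h * 0 : R).
  by apply: cvgM; [exact: q_asymp|exact: isq_c0].
have H2 : c0 (2 * ftheta q).
  move: H; rewrite mulr0 (_ : (fun n => _ / _ * _) = (fun n => (2 * ftheta q)$n)) //.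
  by apply/funext => n; rewrite divfK // gt_eqF // isq_gt0.
apply/c0P; have -> : ftheta q = fC (1 / 2) * (2 * ftheta q).
  by rewrite mulrA -fC_nat -fCM (_ : 1 / 2 * 2 = 1 :> R) ?(fC_nat R 1) ?mul1r //; field.
by rewrite mulrC; apply: c0M => //; exact: l1_C.
Qed.
Let sy : smooth y.
Proof. by rewrite yE; apply: smoothM; [exact: smoothC|smooth_tac]. Qed.
Let sm : smooth m.
Proof.
apply: (@smooth_renewal _ _ (k%:R * Z) (2%:R * y)).
- by apply: fnonnegM => //; exact: fnonneg_nat.
- by rewrite fcoefM0 y00 mulr0.
- by smooth_tac.
- have hh : sums_to (2%:R * y) (2 * (rho * rr)) by rewrite yd; sum_tac.
  rewrite hh.2; have := req; have := sv_sg_le k2 sv.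
  by have := rho0; have := sg0; nra.
- by smooth_tac.
- by rewrite {1}mE yd; ring.
Qed.
Let su : smooth u. Proof. by rewrite uE; smooth_tac. Qed.
Let sf : smooth f.
Proof.
apply: (smooth_renewal u0 _ su u1 _ fE'); last by rewrite gd -yd; smooth_tac.
by rewrite uE fcoefB q00 coefZM subr0.
Qed.
Let sx : smooth x.
Proof.
apply: (@smooth_renewal _ _ (k%:R * Z + Z * f ^+ 2 + 2 * Z * (f - k%:R * S) ^+ 2)
  (2%:R * Z * (r - m) + 2%:R * Z * (r - S))).
- by nonneg_tac.
- by rewrite fcoefD Zd !fcoefM0 fcoefX !(mulr0, mul0r, addr0).
- have -> : 2%:R * Z * (r - m) + 2%:R * Z * (r - S) = q - Z - 2 * Z * m.
    by rewrite qd; ring.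
  by smooth_tac.
- have hh : sums_to (2%:R * Z * (r - m) + 2%:R * Z * (r - S))
    (2 * rho * (rr - mm) + 2 * rho * (rr - sg)) by sum_tac.
  by rewrite hh.2; have := mulr_gt0 rho0 mm_gt0; have := req; have := rho0; lra.
- by smooth_tac.
- by rewrite {1}xE; ring.
Qed.
Variable G : fps R.
Hypothesis Gd : G = Z * x + Z * f ^+ 2 - 2 * k%:R ^+ 2 * S * y + 2 * k%:R ^+ 2 * Z * S ^+ 2.
Let sG : smooth G. Proof. by rewrite Gd; smooth_tac. Qed.
Let sumG : fsum G = sing_num k rho sg rr ff xx.
Proof.
have hx : sums_to x xx by [].
have hy : sums_to y (rho * rr) by rewrite yd; sum_tac.
have hG : sums_to G (rho * xx + rho * ff ^+ 2 - 2 * k%:R ^+ 2 * sg * (rho * rr)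
  + 2 * k%:R ^+ 2 * rho * sg ^+ 2) by rewrite Gd; sum_tac.
by rewrite hG.2 /sing_num; ring.
Qed.
Let eG : e = G * W.
Proof.
have : e * (1 - q) = G.
  by rewrite mulrBr mulr1 {1}eE qd Gd yd; ring.
by move=> <-; rewrite -mulrA [_ * W]mulrC WE mulr1.
Qed.

(* Both T = 4 Z (f + e) and theta q are a smooth series times (1 - z)^(-1/2), up to a
   smooth term, and theta q has coefficients 4 rho n r(n-1) for large n. *)
Lemma normalized_ratio : (fun n => (f + e)$n / (n.+1%:R * r$n)) @ \oo -->
  8 * rho * sing_num k rho sg rr ff xx / sing_den k rho sg.
Proof.
pose T := 4 * Z * (f + e).
have HT : (fun n => T$n / (isq R)$n) @ \oo --> 4 * rho * fsum G * h.
  have TE : T = 4 * Z * f + 4 * Z * G * eta * isq R.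
    by rewrite /T eG WbE; ring.
  have -> : (fun n => T$n / (isq R)$n) = (fun n => (4 * Z * f)$n / (isq R)$n) \+
      (fun n => (4 * Z * G * eta * isq R)$n / (isq R)$n).
    by apply/funext => n /=; rewrite TE fcoefD mulrDl.
  have -> : 4 * rho * fsum G * h = 0 + fsum (4 * Z * G * eta).
    have hG : sums_to G (fsum G) by split=> //; case: sG.
    have heta : sums_to eta h by [].
    have hh : sums_to (4 * Z * G * eta) (4 * rho * fsum G * h) by sum_tac.
    by rewrite hh.2 add0r.
  apply: cvgD; last by apply: smooth_transfer; smooth_tac.
  by apply: c0_isq_ratio; have [] : smooth (4 * Z * f) by smooth_tac.
have dd0 : dd != 0 by rewrite gt_eqF // (sing_den_gt0 k2 sv).
have h0 : h != 0 by case: eta_facts.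
have HTq : (fun n => T$n.+1 / (2 * ftheta q)$n.+1) @ \oo --> 4 * rho * fsum G / dd.
  rewrite (cvg_shiftS (fun n => T$n / (2 * ftheta q)$n)).
  have -> : 4 * rho * fsum G / dd = 4 * rho * fsum G * h / (dd * h).
    by field; rewrite h0 dd0.
  have -> : (fun n => T$n / (2 * ftheta q)$n) =
     (fun n => T$n / (isq R)$n / ((2 * ftheta q)$n / (isq R)$n)).
    apply/funext => n; have b0 : (isq R)$n != 0 by rewrite gt_eqF // isq_gt0.
    by rewrite invf_div mulrA divfK.
  by apply: cvgM => //; apply: cvgV => //; rewrite mulf_neq0.
have -> : 8 * rho * sing_num k rho sg rr ff xx / sing_den k rho sg =
    2 * (4 * rho * fsum G / dd) by rewrite sumG /dd; ring.
have : (fun n => 2 * (T$n.+1 / (2 * ftheta q)$n.+1)) @ \oo --> 2 * (4 * rho * fsum G / dd).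
  by apply: cvgM => //; exact: cvg_cst.
apply: cvg_trans; apply: near_eq_cvg; exists (2 * k).+1 => // n /= kn.
have -> : T$n.+1 = 4 * rho * (f + e)$n.
  have -> : T = Z * (fC 4 * (f + e)) by rewrite fC_nat /T; ring.
  by rewrite coefZM fcoefCM; ring.
have -> : (2 * ftheta q)$n.+1 = 2 * (n.+1%:R * (4 * rho * r$n)).
  rewrite -fC_nat fcoefCM fcoef_theta coefq.
  rewrite Sd fcoefCM fcoefXX.
  by rewrite !gtn_eqF ?mulr0 ?subr0 ?add0r; [ring|lia|lia].
have rho0' : rho != 0 by rewrite gt_eqF.
(* If r(n) = 0, both quotients are 0 by the convention for the inverse of 0. *)
have [->|rn0] := eqVneq (r$n) 0; first by rewrite !mulr0 invr0 !mulr0.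
have n0 : n.+1%:R != 0 :> R by rewrite pnatr_eq0.
move: (n.+1%:R) (r$n) n0 rn0 => c d c0 d0.
by field; rewrite c0 d0 rho0'.
Qed.
End Normalized.

(** * The radius of convergence and the limit of lambda *)

Section Radius.
Variable R : realType.
Local Notation C := R[i].
Local Notation toC := (real_complex R).

Lemma discr_hornerC k rho sg (z : C) : (map_poly toC (discr k rho sg)).[z] =
  (1 - rho%:C * z + 2 * (rho%:C * z) * (sg%:C * z ^+ (2 * k))) ^+ 2
  - 8 * (rho%:C * z) ^+ 2 * (k.+1%:R + (sg%:C * z ^+ (2 * k)) ^+ 2).
Proof.
have hn n : (n%:R : {poly C}).[z] = n%:R by rewrite -polyC_natr hornerC.
have h1 : (1 : {poly C}).[z] = 1 by exact: hornerC.
rewrite /discr !(rmorph_nat, rmorph1, rmorphXn, rmorphB, rmorphD, rmorphM) /=.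
rewrite !map_polyC !map_polyX /=.
by rewrite !(hn, h1, hornerX, hornerC, horner_exp, hornerD, hornerN, hornerM).
Qed.

Lemma min_norm_seq (rs : seq C) : rs != [::] ->
  exists2 z, z \in rs & forall y, y \in rs -> `|z| <= `|y|.
Proof.
elim: rs => // a [_ _|b rs IH _]; first by exists a => [|y]; rewrite ?inE // => /eqP->.
have [//|z zr zm] := IH.
have [az|za] := real_leP (normr_real a) (normr_real z).
  exists a; first by rewrite inE eqxx.
  by move=> y; rewrite inE => /orP[/eqP->//|/zm]; exact: le_trans.
exists z; first by rewrite inE zr orbT.
by move=> y; rewrite inE => /orP[/eqP->|/zm//]; exact: ltW.
Qed.

Lemma radius_exists k (s : R) : exists2 rho : R, 0 < rho &
  (forall z : C, root (map_poly toC (discr k rho (s * rho ^+ (2 * k)))) z -> 1 <= `|z|)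
  /\ (exists2 z : C, root (map_poly toC (discr k rho (s * rho ^+ (2 * k)))) z & `|z| = 1).
Proof.
pose P := map_poly toC (discr k 1 s).
have scale rho z : (map_poly toC (discr k rho (s * rho ^+ (2 * k)))).[z] = P.[rho%:C * z].
  have E : (s * rho ^+ (2 * k))%:C * z ^+ (2 * k) = s%:C * (rho%:C * z) ^+ (2 * k).
    by rewrite rmorphM rmorphXn /= exprMn mulrA.
  by rewrite /P !discr_hornerC E rmorph1 !mul1r.
have P0 : P.[0] = 1.
  by rewrite /P discr_hornerC mulr0 subr0 !mulr0 mul0r addr0 expr0n /= mulr0 mul0r subr0 expr1n.
have Pn0 : P != 0.
  by apply/eqP => E; move/eqP: P0; rewrite E horner0 eq_sym oner_eq0.
have [rs PE] := closed_field_poly_normal P.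
have lP : lead_coef P != 0 by rewrite lead_coef_eq0.
have rootP z : root P z = (z \in rs) by rewrite PE rootZ // root_prod_XsubC.
(* D has a root because it is not constant: D(0) - D(1) = 4 s^2 + 8 (k + 1) + 1 > 0. *)
have rsn : rs != [::].
  apply/eqP => rs0; move: PE; rewrite rs0 big_nil => PE.
  have : P.[1] = 1 by rewrite -P0 PE !hornerZ !hornerC.
  rewrite /P discr_hornerC rmorph1 expr1n => /esym/eqP; rewrite -subr_eq0 => /eqP E.
  have : (4 * s ^+ 2 + 8 * k.+1%:R + 1)%:C = 0 :> C.
    rewrite !rmorphD !rmorphM rmorph1 !rmorph_nat.
    by rewrite -[RHS]E; ring.
  have p0 : 0 < 4 * s ^+ 2 + 8 * k.+1%:R + 1.
    by rewrite ltr_wpDl // addr_ge0 // mulr_ge0 // sqr_ge0.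
  by move/eqP; rewrite fmorph_eq0 gt_eqF.
have [z zr zm] := min_norm_seq rsn.
have z0 : z != 0.
  by apply/eqP => z0; move: zr; rewrite -rootP z0 /root P0 oner_eq0.
pose rho := complex.Re `|z|.
have rhoE : rho%:C = `|z| by rewrite /rho RRe_real // normr_real.
have rho0 : 0 < rho by rewrite -ltcR rhoE normr_gt0.
have rhoC0 : rho%:C != 0 by rewrite rhoE normr_eq0.
exists rho => //; split=> [w|].
  rewrite /root scale -/(root _ _) rootP => /zm.
  have nr : `|rho%:C| = rho%:C by rewrite rhoE normr_id.
  by rewrite normrM nr -rhoE -[leLHS]mulr1 ler_pM2l // rhoE normr_gt0.
exists (z / rho%:C); first by rewrite /root scale mulrC divfK // -/(root _ _) rootP.
by rewrite normrM normfV rhoE normr_id divff // normr_eq0.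
Qed.
End Radius.

(** * Explicit bounds on the constant when rho is small *)

Section SingularBound.
Variables (R : realFieldType) (k : nat) (rho sg r m f x : R).
Hypotheses (k2 : (2 <= k)%N) (sv : singular_values k rho sg r m f x).
Hypothesis r18 : rho <= 1 / 18.
Local Notation a := (1 - rho + 2 * rho * sg).
Local Notation w := (sg * (r - sg)).

Lemma sv_a_bounds : 1 - rho <= a <= 1.
Proof.
have r0 := sv_rho sv; have sgh := sv_sg_le k2 sv.
have rsg : 0 <= rho * sg by rewrite mulr_ge0 ?(sv_sg sv) // ltW.
have : rho * sg <= rho * (1 / 2) by rewrite ler_pM2l.
by move=> h; apply/andP; split; lra.
Qed.

(* k rho^2 is bounded below, which makes all the error terms O(rho). *)
Lemma sv_krho2_ge : 1 <= 28 * (k%:R * rho ^+ 2).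
Proof.
have /andP[a1 a2] := sv_a_bounds; have r0 := sv_rho sv; have dE := sv_deq sv.
have k2' : 2 <= k%:R :> R by rewrite ler_nat.
have r2 : rho ^+ 2 <= (1 / 18) ^+ 2 by rewrite ler_pXn2r ?nnegrE //; lra.
have s2 : sg ^+ 2 <= (1 / 2) ^+ 2.
  by rewrite ler_pXn2r ?nnegrE ?(sv_sg sv) ?(sv_sg_le k2 sv) //; lra.
have : rho ^+ 2 * sg ^+ 2 <= (1 / 18) ^+ 2 * (1 / 2) ^+ 2.
  by apply: ler_pM => //; rewrite sqr_ge0.
have p17 : 0 <= 17 / 18 :> R by lra.
have a17 : 17 / 18 <= a by apply: le_trans a1; have := r18; lra.
have : (17 / 18) ^+ 2 <= a ^+ 2 := lerXn2r 2 p17 (le_trans p17 a17) a17.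
rewrite dE -natr1; lra.
Qed.

(** From k sg <= 1 and the lower bound on k rho^2, sg is O(rho^2), while r is at most 1 / (4
    rho). *)
Lemma sv_sgr_bounds : 0 <= w <= 7 * rho.
Proof.
have /andP[a1 a2] := sv_a_bounds; have rho0 := sv_rho sv; have sg0 := sv_sg sv.
have k0 : 0 < k%:R :> R by rewrite ltr0n; lia.
rewrite mulr_ge0 ?subr_ge0 ?(sv_sgr sv) //=.
have sg_rho : sg <= 28 * rho ^+ 2.
  rewrite -(ler_pM2l k0) mulrCA; exact: le_trans (sv_ksg_le1 sv) sv_krho2_ge.
have H : (4 * rho) * (sg * r) = sg * a by rewrite (sv_req sv); ring.
have H2 : sg * a <= sg * 1 by rewrite ler_wpM2l.
have : (4 * rho) * (sg * r) <= (4 * rho) * (7 * rho) by rewrite H; lra.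
rewrite ler_pM2l; last by rewrite mulr_gt0.
by apply: le_trans; rewrite mulrBr gerBl mulr_ge0.
Qed.

(** m cancels between its own equation and that of f, leaving rho f = (1 - a/2)(1 - 2w) with a = 1 +
    O(rho) and w = O(rho). *)
Lemma sv_rhof_near : `|rho * f - 1 / 2| <= 12 * rho.
Proof.
have /andP[a1 a2] := sv_a_bounds; have /andP[w1 w2] := sv_sgr_bounds.
have rfE : rho * f = (1 - a / 2) * (1 - 2 * w).
  have mne : m != 0 by rewrite gt_eqF // (sv_m sv).
  have kE : k%:R * rho = (1 - a / 2) * m.
    have h : k%:R * rho = m - 2 * rho * r * m by rewrite {1}(sv_meq sv); ring.
    by rewrite h (sv_req sv); field.
  apply: (mulfI mne).
  have -> : m * (rho * f) = f * (rho * m) by ring.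
  rewrite (sv_feq sv); transitivity (k%:R * rho * (1 - 2 * w)); first by ring.
  by rewrite kE; ring.
rewrite rfE; move: (a) (w) a1 a2 w1 w2 => b v b1 b2 v1 v2.
have rho1 := r18; have : 0 <= (1 - b / 2) * v by rewrite mulr_ge0 //; lra.
have : (1 - b / 2) * v <= 3 / 4 * v by rewrite ler_wpM2r //; lra.
by rewrite ler_norml; lra.
Qed.

(** As m >= k rho, the equation of x gives 2 (k rho^2) rho^2 x <= rho (k rho^2 + 3). Dividing with k
    rho^2 >= 1/28 yields 1/2 + 42 <= 43. *)
Lemma sv_rho2x_bounds : 0 <= rho ^+ 2 * x <= 43 * rho.
Proof.
have rho0 := sv_rho sv; have x0 := sv_x sv; have f0 := sv_f sv.
have k0 : 0 < k%:R :> R by rewrite ltr0n; lia.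
have rho2 : 0 < rho ^+ 2 by rewrite exprn_gt0.
have kr0 : 0 < 2 * (k%:R * rho ^+ 2) by rewrite mulr_gt0 // mulr_gt0.
have fg : (f - k%:R * sg) ^+ 2 <= f ^+ 2.
  have ksf : k%:R * sg <= f.
    apply: le_trans (sv_sgf sv) _; rewrite ger_pMl //.
    by have := r18; lra.
  rewrite ler_pXn2r ?nnegrE ?subr_ge0 //; last exact: ltW.
  by rewrite gerBl mulr_ge0 ?(sv_sg sv) // ltW.
have xm : x * (2 * rho * (k%:R * rho)) <= k%:R * rho + 3 * (rho * f ^+ 2).
  apply: (@le_trans _ _ (x * (rho + 2 * rho * m))).
    apply: ler_wpM2l => //; apply: (@le_trans _ _ (2 * rho * m)).
      by apply: ler_wpM2l; [rewrite mulr_ge0 // ltW|exact: (sv_m_ge sv)].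
    by rewrite lerDr ltW.
  have : rho * (f - k%:R * sg) ^+ 2 <= rho * f ^+ 2 by rewrite ler_pM2l.
  rewrite (sv_xeq sv) -[2 * rho * _ ^+ 2]mulrA.
  move: (rho * (_ - _) ^+ 2) (rho * f ^+ 2) => t v; lra.
have rf1 : (rho * f) ^+ 2 <= 1.
  by rewrite exprn_ile1 ?(sv_rf_le1 sv) // mulr_ge0 // ltW.
rewrite mulr_ge0 ?(ltW rho2) //= -(ler_pM2r kr0).
have -> : rho ^+ 2 * x * (2 * (k%:R * rho ^+ 2)) =
  rho ^+ 2 * (x * (2 * rho * (k%:R * rho))) by ring.
apply: (@le_trans _ _ (rho ^+ 2 * (k%:R * rho + 3 * (rho * f ^+ 2)))).
  by rewrite ler_pM2l.
have -> : rho ^+ 2 * (k%:R * rho + 3 * (rho * f ^+ 2)) =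
  rho * (k%:R * rho ^+ 2 + 3 * (rho * f) ^+ 2) by ring.
rewrite [43 * rho]mulrC -[leRHS]mulrA ler_pM2l //.
have := sv_krho2_ge; move: (k%:R * rho ^+ 2) ((rho * f) ^+ 2) rf1 => s t; lra.
Qed.

(** By k^2 sg <= rho x this is at most rho^2 x times 2 rho r <= 1/2: half of the previous bound. *)
Lemma sv_rho2y_bounds : 0 <= 2 * rho ^+ 2 * k%:R ^+ 2 * w <= 22 * rho.
Proof.
have /andP[a1 a2] := sv_a_bounds; have /andP[w1 _] := sv_sgr_bounds.
have /andP[x1 x2] := sv_rho2x_bounds; have rho0 := sv_rho sv; have sg0 := sv_sg sv.
have rho2 : 0 < rho ^+ 2 by rewrite exprn_gt0.
apply/andP; split.
  by rewrite mulr_ge0 // mulr_ge0 ?sqr_ge0 // mulr_ge0 // ltW.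
have H : k%:R ^+ 2 * sg * (r - sg) <= rho * x * r.
  by apply: ler_pM; rewrite ?subr_ge0 ?mulr_ge0 ?gerBl ?sqr_ge0 ?(sv_sgr sv) ?(sv_sgx sv).
have -> : 2 * rho ^+ 2 * k%:R ^+ 2 * w = 2 * rho ^+ 2 * (k%:R ^+ 2 * sg * (r - sg)).
  by ring.
apply: (@le_trans _ _ (2 * rho ^+ 2 * (rho * x * r))).
  by rewrite ler_pM2l // mulr_gt0.
have -> : 2 * rho ^+ 2 * (rho * x * r) = rho ^+ 2 * x * (4 * rho * r) / 2 by field.
rewrite -(sv_req sv); have : rho ^+ 2 * x * a <= rho ^+ 2 * x * 1 by rewrite ler_wpM2l.
move: (rho ^+ 2 * x) (rho ^+ 2 * x * a) x1 x2 rho0 => s t; lra.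
Qed.

(** Of the three terms of rho G(rho) only (rho f)^2 survives, near 1/4. *)
Lemma sing_num_near : `|8 * rho * sing_num k rho sg r f x - 2| <= 664 * rho.
Proof.
have -> : 8 * rho * sing_num k rho sg r f x = 8 * (rho ^+ 2 * x
    + (rho * f - 1 / 2 + 1 / 2) ^+ 2 - 2 * rho ^+ 2 * k%:R ^+ 2 * w).
  by rewrite /sing_num; ring.
have := sv_rho2x_bounds; have := sv_rho2y_bounds; have := sv_rhof_near.
move: (rho * f - 1 / 2) (2 * rho ^+ 2 * _ * _) (rho ^+ 2 * x) (sv_rho sv) r18.
move=> d Y X; move: (rho) => t t0 t18 dB /andP[Y1 Y2] /andP[X1 X2].
have : `|(d + 1 / 2) ^+ 2 - 1 / 4| <= 20 * t.
  have -> : (d + 1 / 2) ^+ 2 - 1 / 4 = d * (d + 1) by field.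
  (* |d| <= 12 t <= 2/3 since t <= 1/18, hence |d + 1| <= 5/3. *)
  rewrite normrM; apply: (@le_trans _ _ (12 * t * (5 / 3))); last by lra.
  by apply: ler_pM => //; move: dB; rewrite !ler_norml; lra.
rewrite !ler_norml; lra.
Qed.

Lemma sing_den_near : `|sing_den k rho sg - 2| <= 18 * rho.
Proof.
have /andP[a1 a2] := sv_a_bounds; have rho0 := sv_rho sv; have sg0 := sv_sg sv.
have ks0 : 0 <= k%:R * sg by rewrite mulr_ge0.
pose t := rho * (k%:R * sg).
have t0 : 0 <= t by rewrite mulr_ge0 // ltW.
have t1 : t <= rho by rewrite ger_pMr // (sv_ksg_le1 sv).
have at0 : 0 <= a * t by rewrite mulr_ge0 //; have := r18; lra.
have at1 : a * t <= t by rewrite ler_piMl.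
have s0 : 0 <= rho * sg by rewrite mulr_ge0 // ltW.
have s1 : rho * sg <= 1 / 18 * (1 / 2).
  by apply: ler_pM => //; [exact: ltW|exact: (sv_sg_le k2 sv)].
have ts0 : 0 <= t * (rho * sg) by rewrite mulr_ge0.
have ts1 : t * (rho * sg) <= t * (1 / 18 * (1 / 2)) by rewrite ler_wpM2l.
have -> : sing_den k rho sg = 2 * a - 8 * (a * t) + 32 * (t * (rho * sg)).
  by rewrite /sing_den /t; ring.
move: a (a * t) (t * (rho * sg)) a1 a2 at0 at1 ts0 ts1 => b u v b1 b2 u0 u1 v0 v1.
rewrite ler_norml; lra.
Qed.

(** Numerator and denominator differ by at most (664 + 18) rho, and the threshold 1/18 keeps the
    denominator at least 1. *)
Lemma sing_ratio_bound :
  `|8 * rho * sing_num k rho sg r f x / sing_den k rho sg - 1| <= 700 * rho.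
Proof.
have := sing_num_near; have := sing_den_near.
move: (sing_den k rho sg) (8 * rho * _) (sv_rho sv) r18 => D N.
move: (rho) => t t0 t18 DB NB.
have D1 : 1 <= D by move: DB; rewrite ler_norml; lra.
have D0 : 0 < D by lra.
have -> : N / D - 1 = (N - D) / D by rewrite mulrBl divff // gt_eqF.
rewrite normrM normfV [`|D|]gtr0_norm // ler_pdivrMr //.
apply: (@le_trans _ _ (700 * t)); last by rewrite ler_peMr // mulr_ge0 // ltW.
move: DB NB; rewrite !ler_norml; lra.
Qed.
End SingularBound.

(** * The ratio for a fixed alphabet, and the decay of rho *)

Lemma cvg_dist (R : realType) (u : nat -> R) (l e : R) : u @ \oo --> l -> 0 < e ->
  exists N, forall n, (N <= n)%N -> `|l - u n| < e.
Proof. by move/cvgrPdist_lt => H /H [N _ HN]; exists N. Qed.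

Section Asymptotics.
Variables (R : realType) (k : nat).
Hypothesis k2 : (2 <= k)%N.

Lemma transition_ratio : exists rho sg r m f x : R,
  singular_values k rho sg r m f x /\
  (fun n => (t_count k n)%:R / (n.+1%:R * (r_count k n)%:R)) @ \oo -->
    8 * rho * sing_num k rho sg r f x / sing_den k rho sg.
Proof.
pose s := (Sgf R k)$(2 * k).
have [rho rho0 [ge1 root1]] := radius_exists k s.
have sg0 : 0 <= s * rho ^+ (2 * k) by rewrite mulr_ge0 ?Sgf_ge0 // exprn_ge0 // ltW.
pose sc := fscale rho.
have scX : sc fX = fC rho * fX by exact: fscaleX.
have scS : sc (Sgf R k) = fC (s * rho ^+ (2 * k)) * fX ^+ (2 * k).
  rewrite Sgf_monomial /sc rmorphM rmorphXn /= fscaleC fscaleX fCM exprMn mulrA.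
  by rewrite -/s /fC [(rho ^+ _)%:P]rmorphXn rmorphXn.
have scE := (rmorph_nat (fscale rho), rmorphXn (fscale rho), rmorphB (fscale rho),
  rmorphD (fscale rho), rmorphM (fscale rho)).
have nn a : fnonneg a -> fnonneg (sc a).
  by move=> a0 n; rewrite fcoef_scale mulr_ge0 // exprn_ge0 // ltW.
have sle a b : (forall n, a$n <= b$n) -> forall n, (sc a)$n <= (sc b)$n.
  by move=> ab n; rewrite !fcoef_scale ler_wpM2l // exprn_ge0 // ltW.
have rE := congr1 sc (Rgf_eq R k); have mE := congr1 sc (Mgf_eq R k).
have fE := congr1 sc (Fgf_eq R k); have xE := congr1 sc (Xgf_eq R k).
have eE := congr1 sc (Egf_eq R k).
rewrite /sc ?scE in rE mE fE xE eE.
have sf n : k%:R * (sc (Sgf R k))$n <= (sc fX * sc (Fgf R k))$n.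
  rewrite -rmorphM !fcoef_scale mulrCA ler_wpM2l ?Fgf_ge_Sgf //.
  by rewrite exprn_ge0 // ltW.
have sx n : k%:R ^+ 2 * (sc (Sgf R k))$n <= (sc fX * sc (Xgf R k))$n.
  rewrite -rmorphM !fcoef_scale mulrCA ler_wpM2l ?Xgf_ge_Sgf //.
  by rewrite exprn_ge0 // ltW.
have m0 := nn _ (@Mgf_ge0 R k); have f0 := nn _ (@Fgf_ge0 R k).
have x0 := nn _ (@Xgf_ge0 R k).
have Sr := sle _ _ (@Sgf_le_Rgf R k); have mr := sle _ _ (@Mgf_le_Rgf R k).
exists rho, (s * rho ^+ (2 * k)), (fsum (sc (Rgf R k))), (fsum (sc (Mgf R k))),
  (fsum (sc (Fgf R k))), (fsum (sc (Xgf R k))); split.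
  (* Each [erefl] gives an auxiliary series its defining expression. *)
  exact: (normalized_values k2 rho0 sg0 scX scS rE mE fE xE m0 f0 x0 Sr mr sf sx
    ge1 root1 erefl erefl erefl).
have := normalized_ratio k2 rho0 sg0 scX scS rE mE fE xE eE m0 f0 x0 Sr mr sf sx
    ge1 root1 erefl erefl erefl erefl erefl erefl erefl.
rewrite (_ : (fun n => _) = (fun n => (t_count k n)%:R / (n.+1%:R * (r_count k n)%:R))) //.
apply/funext => n; rewrite -rmorphD !fcoef_scale t_count_gf Rgf_count.
have rn : rho ^+ n != 0 by rewrite expf_neq0 // gt_eqF.
by rewrite [n.+1%:R * (_ * _)]mulrCA -mulf_div divff // mul1r.
Qed.

Lemma transition_rate : exists2 lam : R,
  (forall e, 0 < e -> exists N, forall n, (N <= n)%N ->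
    `|(t_count k n)%:R / (r_count k n)%:R / (lam * n%:R) - 1| < e) &
  exists2 rho, 0 < rho & 8 * rho ^+ 2 * k.+1%:R <= 1 /\
    (rho <= 1 / 18 -> `|lam - 1| <= 700 * rho).
Proof.
have [rho [sg [r [m [f [x [sv H]]]]]]] := transition_ratio.
set lam := 8 * rho * sing_num k rho sg r f x / sing_den k rho sg in H.
have lam0 : lam != 0.
  have n0 := sing_num_gt0 sv; have d0 := sing_den_gt0 k2 sv; have r0 := sv_rho sv.
  by rewrite gt_eqF // divr_gt0 // mulr_gt0 // mulr_gt0.
exists lam; last first.
  exists rho; first exact: sv_rho sv.
  split; [exact: (sv_rho_le k2 sv)|exact: (sing_ratio_bound k2 sv)].
(* The known limit has the factor n + 1 in its denominator. At index n + 1 this is n + 2, and 1 +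
   [harmonic n] = (n + 2) / (n + 1) corrects it. *)
clearbody lam; have Hn : (cst 1 \+ @harmonic R) @ \oo --> (1 + 0 : R).
  by apply: cvgD; [exact: cvg_cst|exact: cvg_harmonic].
rewrite addr0 in Hn.
pose v n : R := (t_count k n)%:R / (n.+1%:R * (r_count k n)%:R).
have H1 : (fun n => v n.+1) @ \oo --> lam by rewrite (cvg_shiftS v).
have H2 : (fun n => v n.+1 * lam^-1 * (1 + harmonic n)) @ \oo --> lam * lam^-1 * 1.
  exact: (cvgM (cvgM H1 (cvg_cst _)) Hn).
rewrite divff // mulr1 in H2.
move=> e e0; have [N HN] := cvg_dist H2 e0.
exists N.+1 => -[//|n] /HN /=; rewrite distrC /v /=; congr (`|_ - 1| < _).
have n1 : n.+1%:R != 0 :> R by rewrite pnatr_eq0.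
have n2 : n.+2%:R != 0 :> R by rewrite pnatr_eq0.
have -> : 1 + (n.+1%:R)^-1 = n.+2%:R / n.+1%:R :> R.
  by rewrite -[n.+2%:R]natr1 mulrDl divff // mul1r.
rewrite !invfM; move: (r_count k n.+1)%:R^-1 => ri.
move: (n.+2%:R) (n.+1%:R) n2 n1 => a b a0 b0.
by field; rewrite a0 b0 lam0.
Qed.
End Asymptotics.

Lemma radius_small (R : realType) (e : R) : 0 < e -> exists K, forall n (rho : R),
  (K <= n)%N -> 0 < rho -> 8 * rho ^+ 2 * n.+1%:R <= 1 -> rho <= 1 / 18 /\ 700 * rho < e.
Proof.
(* The summand 41 makes n + 1 >= 42, and 8 * 42 exceeds 18^2; the other summand serves 700 rho <
   e. *)
move=> e0; exists (Num.bound ((700 / e) ^+ 2) + 41)%N => n rho Kn rho0 H.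
have r20 : 0 < rho ^+ 2 by rewrite exprn_gt0.
have n42 : 42 <= n.+1%:R :> R by rewrite ler_nat; lia.
have nb : (700 / e) ^+ 2 < n.+1%:R.
  apply: lt_le_trans (archi_boundP _) _; first exact: sqr_ge0.
  by rewrite ler_nat; lia.
split.
  rewrite -(@ler_pXn2r _ 2) ?nnegrE //; [|exact: ltW|lra].
  have : rho ^+ 2 * 42 <= rho ^+ 2 * n.+1%:R by rewrite ler_pM2l.
  lra.
have H1 : rho ^+ 2 * (700 / e) ^+ 2 < 1.
  have : rho ^+ 2 * (700 / e) ^+ 2 < rho ^+ 2 * n.+1%:R by rewrite ltr_pM2l.
  have : 0 <= rho ^+ 2 * n.+1%:R by rewrite mulr_ge0 // ltW.
  lra.
have E : 700 * rho = rho * (700 / e) * e by rewrite -mulrA divfK ?gt_eqF // mulrC.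
rewrite E -[X in _ < X]mul1r ltr_pM2r //.
have p0 : 0 <= rho * (700 / e) by rewrite mulr_ge0 ?divr_ge0 // ltW.
by rewrite -(@ltr_pXn2r _ 2) ?nnegrE // expr1n exprMn.
Qed.

(** * Passage to the real numbers of Stdlib *)

Section StdlibReals.
Local Notation SR := Rdefinitions.R.

Lemma is_lim_seqP (u : nat -> SR) (l : SR) :
  (forall e : SR, (0 : SR) < e -> exists N, forall n, (N <= n)%N -> `|u n - l| < e) ->
  is_lim_seq u l.
Proof.
move=> H; apply/is_lim_seq_spec => eps; have [|N HN] := H (pos eps).
  by apply/RltP; exact: cond_pos.
by exists N => n /ssrnat.leP /HN /RltP; rewrite -RabsE.
Qed.

Lemma lam_exists k : exists lam : SR, (2 <= k)%N ->
  (forall e : SR, (0 : SR) < e -> exists N, forall n, (N <= n)%N ->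
    `|(t_count k n)%:R / (r_count k n)%:R / (lam * n%:R) - 1| < e) /\
  (exists2 rho : SR, 0 < rho & 8 * rho ^+ 2 * k.+1%:R <= 1 /\
    (rho <= 1 / 18 -> `|lam - 1| <= 700 * rho)).
Proof.
(* A dummy value below two letters, as [choice] asks for a value at every k. *)
case: (leqP 2 k) => [k2|]; last by exists 0.
by have [lam H1 H2] := @transition_rate SR k k2; exists lam.
Qed.
End StdlibReals.

Delimit Scope R_scope with R.
Local Close Scope ring_scope.
Local Close Scope complex_scope.
Local Close Scope classical_set_scope.

Theorem theorem7 :
  exists lam : nat -> R,
    (forall k : nat, is_true (leq 2 k) ->
       is_lim_seq
         (fun n : nat =>
            (INR (t_count k n) / INR (r_count k n)) / (lam k * INR n))%R
         1%R)
    /\ is_lim_seq lam 1%R.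
Proof.
have [lam H] := choice lam_exists.
exists lam; split=> [k /H [Hk _]|].
  apply: is_lim_seqP => e /Hk [N HN]; exists N => n /HN.
  by rewrite !RdivE RmultE !INRE.
apply: is_lim_seqP => e e0.
have [K HK] := radius_small e0.
exists (maxn 2 K) => n; rewrite geq_max => /andP[n2 Kn].
have [_ [rho rho0 [rhoB lamB]]] := H n n2.
have [r18 re] := HK n rho Kn rho0 rhoB.
exact: Order.POrderTheory.le_lt_trans (lamB r18) re.
Qed.
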